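(* Let $\omega>0$, $\sigma>0$, $\lambda>0$, let $z\in\mathcal{B}_\omega$ and $f_\sigma=\phi_\sigma*z$. Let $F_2(u)=\int_{\mathbb{R}}|u'|+\lambda\|\phi_\sigma*u-f_\sigma\|_{L^2(\mathbb{R})}^2$. The following hold. (1) Let $\phi_\sigma\in\mathcal{K}$. Then $u\equiv0$ is the unique minimiser of $F_2$ over $BV(\mathbb{R})$ if and only if $\|\phi_\sigma*f_\sigma\|_*\le\frac1{2\lambda}$. (2) Let $\phi_\sigma=\hat\phi_\sigma$ and $z\in\mathcal{B}_\omega^{ij}$ for some $i,j\in\{0,1\}$. If $\sigma\le\frac\omega2$ and $\lambda>0$ satisfy $$\frac2\lambda+\frac{21}{15}\sigma<\omega,$$ then $u=z$ is the unique minimiser of $F_2$ over $\mathcal{B}^{ij}$.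
   Context: Functions are identified when equal almost everywhere, and $\int_{\mathbb{R}}|u'|$ denotes the total variation of $u$ on $\mathbb{R}$. Bar codes: $\mathcal{B}=\{u\in BV(\mathbb{R};\{0,1\}): u=0 \text{ a.e. in } \mathbb{R}\setminus[0,1]\}$. Up to null sets, for $u\in\mathcal{B}$ the set $\{x\in[0,1]:u(x)=1\}$ is a finite disjoint union of non-empty (nondegenerate) intervals $b_i$ (bars), and $\{x\in[0,1]:u(x)=0\}$ is a finite disjoint union of non-empty intervals $w_i$ (white spaces). For $\omega>0$, $\mathcal{B}_\omega$ is the set of $u\in\mathcal{B}$ all of whose bars and white spaces satisfy $|b_i|\ge\omega$, $|w_i|\ge\omega$. For $i,j\in\{0,1\}$, $\mathcal{B}^{ij}$ (resp. $\mathcal{B}_\omega^{ij}$) is the set of $u\in\mathcal{B}$ (resp. $u\in\mathcal{B}_\omega$) for which there exist $x_1\in(0,1]$ and $x_2\in[0,1)$ with $u=i$ on $[0,x_1]$ and $u=j$ on $[x_2,1]$; i.e. $u$ starts with a bar if $i=1$ and with a space if $i=0$, and ends with a bar if $j=1$ and with a space if $j=0$. Kernels: $\mathcal{K}$ is the class of $\phi_\sigma\in L^1(\mathbb{R})$, with parameter $\sigma>0$ (the subscript), of the form $\phi_\sigma(x)=p(-x,\sigma)\chi_{[-\sigma,0]}(x)+p(x,\sigma)\chi_{[0,\sigma]}(x)$, where $p(\cdot,\sigma)$ is non-negative and monotonically decreasing on $[0,\sigma]$ with $\int_0^\sigma p(x,\sigma)\,dx=\frac12$. The hat function is $\hat\phi_\sigma(x)=\frac1\sigma\left(1-\frac{|x|}{\sigma}\right)$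 for $|x|<\sigma$ and $\hat\phi_\sigma(x)=0$ for $|x|\ge\sigma$. Dual norm: $\|f\|_*=\sup\left\{\left|\int_{\mathbb{R}}fv\right| : v\in L^1(\mathbb{R}),\ \int_{\mathbb{R}}|v'|\le 1\right\}$. *)

(* Defs.v *)
From HB Require Import structures.
From mathcomp Require Import all_boot all_order all_algebra.
From mathcomp Require Import all_classical all_reals all_analysis.

Set Implicit Arguments.
Unset Strict Implicit.
Unset Printing Implicit Defensive.

Import Order.TTheory GRing.Theory Num.Theory.
Import numFieldNormedType.Exports.

Local Open Scope classical_set_scope.
Local Open Scope ring_scope.

(* Elements of L^1(R), BV(R), ... are represented by functions R -> R;
   functions are identified up to [%[ae lebesgue_measure]]. *)

Section BarCodes.
Variable R : realType.

Local Notation mu := (@lebesgue_measure R).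

Definition L1 : set (R -> R) := [set u | mu.-integrable setT (EFin \o u)].

Definition Cc1 : set (R -> R) :=
  [set g : R -> R | [/\ forall x : R, derivable g x 1,
               continuous (derive1 g) &
               exists M : R, forall x, M < `|x| -> g x = 0]].

(* The total variation \int_R |u'| of the distributional derivative of u; it
   depends only on the class of u modulo null sets. *)
Definition TV (u : R -> R) : \bar R :=
  ereal_sup [set (\int[mu]_x (u x * derive1 g x)%:E)%E
            | g in [set g | Cc1 g /\ forall x, `|g x| <= 1]].

Definition BV : set (R -> R) := [set u | L1 u /\ (TV u < +oo)%E].

Definition convolution (f g : R -> R) : R -> R :=
  fun x => \int[mu]_y (f (x - y) * g y).

Definition dual_norm (f : R -> R) : \bar R :=
  ereal_sup [set `|\int[mu]_x (f x * v x)%:E|%E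
            | v in [set v | L1 v /\ (TV v <= 1)%E]].

Definition barcode : set (R -> R) :=
  [set u | [/\ BV u,
               {ae mu, forall x, u x = 0 \/ u x = 1} &
               {ae mu, forall x, x \notin `[0, 1] -> u x = 0}]].

(* Up to a null set, {x in [0,1] : u x = c} is the disjoint union of the
   nondegenerate intervals ]p.1, p.2[ for p in s.  They are listed from left to
   right and separated by gaps of positive length, so that adjacent intervals
   are merged and s is determined by u and c: for c = true it lists the bars
   of u, for c = false its white spaces. *)
Definition level_intervals (u : R -> R) (c : bool) (s : seq (R * R)) : Prop :=
  [/\ forall p, p \in s -> [/\ 0 <= p.1, p.1 < p.2 & p.2 <= 1],
      pairwise (fun p q : R * R => p.2 < q.1) s &
      {ae mu, forall x, x \in `[0, 1] ->
         (u x = c%:R <-> exists2 p, p \in s & x \in `]p.1, p.2[)}].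

Definition barcode_min (omega : R) : set (R -> R) :=
  [set u | barcode u /\
     exists bars spaces : seq (R * R),
       [/\ level_intervals u true bars,
           level_intervals u false spaces,
           forall b, b \in bars -> omega <= b.2 - b.1 &
           forall w, w \in spaces -> omega <= w.2 - w.1]].

Definition starts_ends (i j : bool) : set (R -> R) :=
  [set u | exists x1 x2 : R,
     [/\ 0 < x1 <= 1, 0 <= x2 < 1,
         {ae mu, forall x, x \in `[0, x1] -> u x = i%:R} &
         {ae mu, forall x, x \in `[x2, 1] -> u x = j%:R}]].

Definition barcode_ij (i j : bool) : set (R -> R) :=
  barcode `&` starts_ends i j.

Definition barcode_min_ij (omega : R) (i j : bool) : set (R -> R) :=
  barcode_min omega `&` starts_ends i j.

Definition kernelK (sigma : R) : set (R -> R) :=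
  [set phi | L1 phi /\ exists p : R -> R,
     [/\ forall x, x \in `[0, sigma] -> 0 <= p x,
         forall x y, x \in `[0, sigma] -> y \in `[0, sigma] -> x <= y -> p y <= p x,
         (\int[mu]_(x in `[0%R, sigma]) (p x)%:E = (2^-1)%:E)%E &
         phi = (fun x => p (- x) * \1_`[- sigma, 0]%classic x
                         + p x * \1_`[0, sigma]%classic x) %[ae mu]]].

Definition hat (sigma : R) : R -> R :=
  fun x => if `|x| < sigma then sigma^-1 * (1 - `|x| / sigma) else 0.

Definition F2 (phi : R -> R) (lambda : R) (f : R -> R) (u : R -> R) : \bar R :=
  (TV u + lambda%:E *
     'N[mu]_2%:E[EFin \o (fun x => convolution phi u x - f x)%R] ^+ 2)%E.

Definition minimiser (F : (R -> R) -> \bar R) (A : set (R -> R)) (u : R -> R) :=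
  A u /\ forall v, A v -> (F u <= F v)%E.

Definition unique_minimiser (F : (R -> R) -> \bar R) (A : set (R -> R))
    (u : R -> R) : Prop :=
  minimiser F A u /\ forall v, minimiser F A v -> v = u %[ae mu].

End BarCodes.

(* Main.v *)
Require Import Defs.
From mathcomp Require Import all_boot all_order all_algebra.
From mathcomp Require Import all_classical all_reals all_analysis.
From mathcomp Require Import measurable_realfun.
From mathcomp Require Import lra.

(* (1) [F2] is convex along rays from 0 and, [phi] being even,
   [F2 v - F2 0 = TV v - 2 lambda <v, phi * f> + lambda |phi * v|^2]: comparing
   the terms of order one in [v] gives the dual norm criterion.  Uniqueness
   needs no injectivity of [phi *]: if [|phi * v| = 0] then also
   [<v, phi * f> = <phi * v, f> = 0], so that [TV v = 0] and [v = 0].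

   (2) View [z] as a function on R with [N] jumps, so that [TV z = N].  Call an
   interval between two consecutive jumps of [z] missed if [u <> z] a.e. on it.
   Choosing a Lebesgue point of [u] with the value of [z] in each interval that
   is not missed gives an alternating sequence, whence [TV u >= N - 2 m] if
   there are [m] missed intervals.  On a missed interval [J] one has
   [u - z = +-1] while [|u - z| <= 1] elsewhere, so, as [2 sigma <= |J|],
   [|phi * (u - z)| >= min (1, d / sigma)] at distance [d] from the ends of [J];
   hence [J] contributes at least [|J| - 4/3 sigma >= omega - 21/15 sigma > 2 / lambda]
   to [|phi * (u - z)|^2].  For [m = 0] the energy of [u] exceeds that of [z]
   unless [phi * (u - z) = 0]; a second difference of the second
   antiderivative of [u - z] then vanishes, which forces [u = z]. *)

Set Implicit Arguments.
Unset Strict Implicit.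
Unset Printing Implicit Defensive.

Import Order.TTheory GRing.Theory Num.Theory.
Import numFieldNormedType.Exports.

Local Open Scope classical_set_scope.
Local Open Scope ring_scope.

(** * Integration on the real line *)

Section Integration.
Context {R : realType}.
Local Notation mu := (@lebesgue_measure R).
Implicit Types f g u v : R -> R.

Lemma ae_filter : Filter (almost_everywhere mu).
Proof. exact: ae_filter_ringOfSetsType. Qed.

Lemma ae_imp (P Q : R -> Prop) : (forall x, P x -> Q x) ->
  {ae mu, forall x, P x} -> {ae mu, forall x, Q x}.
Proof. by move=> PQ PP; exact: (@filterS _ (almost_everywhere mu) ae_filter P Q PQ PP). Qed.

Lemma ae_imp2 (P1 P2 Q : R -> Prop) : (forall x, P1 x -> P2 x -> Q x) ->
  {ae mu, forall x, P1 x} -> {ae mu, forall x, P2 x} -> {ae mu, forall x, Q x}.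
Proof.
move=> PQ P1P P2P.
exact: (@filterS2 _ (almost_everywhere mu) ae_filter P1 P2 Q PQ P1P P2P).
Qed.

Lemma ae_eqP f g :
  f = g %[ae mu] <-> {ae mu, forall x, f x = g x}.
Proof. by split; apply: ae_imp => // x; apply. Qed.

Lemma L1_measurable f : L1 f -> measurable_fun setT f.
Proof. by move=> /measurable_int /measurable_EFinP. Qed.

Lemma L1_cst0 : L1 (fun=> 0 : R).
Proof. exact: integrable0. Qed.

Lemma L1D f g : L1 f -> L1 g -> L1 (fun x => f x + g x).
Proof. by move=> lf lg; exact: (integrableD measurableT lf lg). Qed.

Lemma L1B f g : L1 f -> L1 g -> L1 (fun x => f x - g x).
Proof. by move=> lf lg; exact: (integrableB measurableT lf lg). Qed.

Lemma L1Z k f : L1 f -> L1 (fun x => k * f x).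
Proof. by move=> lf; exact: (integrableZl measurableT k lf). Qed.

Lemma L1_ae_le f g : measurable_fun setT f -> L1 g ->
  {ae mu, forall x, `|f x| <= `|g x|} -> L1 f.
Proof.
move=> mf /integrableP[mg goo] fg; apply/integrableP; split.
  exact/measurable_EFinP.
apply: le_lt_trans goo; apply: ae_ge0_le_integral => //.
- by do 2 apply: measurableT_comp => //.
- by apply: measurableT_comp.
- by move: fg; apply: ae_imp => x fgx _; rewrite /= lee_fin.
Qed.

Lemma L1_le f g : measurable_fun setT f -> L1 g ->
  (forall x, `|f x| <= `|g x|) -> L1 f.
Proof. by move=> mf lg fg; apply: (L1_ae_le mf lg); exact: aeW. Qed.

Lemma L1_mulb f g (M : R) : L1 f -> measurable_fun setT g ->
  {ae mu, forall x, `|g x| <= M} -> L1 (fun x => f x * g x).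
Proof.
move=> lf mg gM; apply: (@L1_ae_le _ (fun x => M * f x)) => //.
- by apply: measurable_funM => //; exact: L1_measurable.
- exact: L1Z.
- move: gM; apply: ae_imp => x gxM; rewrite mulrC !normrM ler_wpM2r//.
  by rewrite (le_trans gxM)// ler_norm.
Qed.

Lemma IntD f g : L1 f -> L1 g ->
  \int[mu]_x (f x + g x) = \int[mu]_x f x + \int[mu]_x g x.
Proof. by move=> *; exact: RintegralD. Qed.

Lemma IntB f g : L1 f -> L1 g ->
  \int[mu]_x (f x - g x) = \int[mu]_x f x - \int[mu]_x g x.
Proof. by move=> *; exact: RintegralB. Qed.

Lemma IntZ k f : L1 f -> \int[mu]_x (k * f x) = k * \int[mu]_x f x.
Proof. by move=> *; exact: RintegralZl. Qed.

Lemma eintegral_Rintegral f : L1 f ->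
  (\int[mu]_x (f x)%:E)%E = (\int[mu]_x f x)%:E.
Proof. by move=> lf; rewrite fineK//; exact: integrable_fin_num. Qed.

Lemma ae_eintegral f g : measurable_fun setT f -> measurable_fun setT g ->
  f = g %[ae mu] -> (\int[mu]_x (f x)%:E = \int[mu]_x (g x)%:E)%E.
Proof.
move=> mf mg fg; apply: ae_eq_integral => //; try exact/measurable_EFinP.
by move: fg; apply: ae_imp => x + _ => /(_ I) /= -> .
Qed.

Lemma ae_Rintegral f g : measurable_fun setT f -> measurable_fun setT g ->
  f = g %[ae mu] -> \int[mu]_x f x = \int[mu]_x g x.
Proof. by move=> mf mg fg; congr fine; exact: ae_eintegral. Qed.

Lemma ae_le_Rintegral f g : L1 f -> L1 g ->
  {ae mu, forall x, f x <= g x} -> \int[mu]_x f x <= \int[mu]_x g x.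
Proof.
move=> lf lg fg; rewrite -subr_ge0 -IntB//.
(* Non-negativity of [g - f] holds only almost everywhere, so it is exchanged for its absolute
   value, which has the same integral. *)
pose k (x : R) : R := `|g x - f x|.
have mk : measurable_fun setT (fun x => g x - f x).
  by apply: L1_measurable; exact: L1B.
rewrite (_ : \int[mu]_x _ = \int[mu]_x k x); first by apply: Rintegral_ge0 => x _; exact: normr_ge0.
apply: ae_Rintegral => //; first exact: measurableT_comp.
by move: fg; apply: ae_imp => x fgx; rewrite /k ger0_norm// subr_ge0.
Qed.

Lemma le_Int f g : L1 f -> L1 g -> (forall x, f x <= g x) ->
  \int[mu]_x f x <= \int[mu]_x g x.
Proof. by move=> lf lg fg; apply: ae_le_Rintegral => //; exact: aeW. Qed.

Lemma L1_norm f : L1 f -> L1 (fun x => `|f x|).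
Proof. exact: integrable_norm. Qed.

Lemma le_norm_Int f : L1 f -> `|\int[mu]_x f x| <= \int[mu]_x `|f x|.
Proof. by move=> lf; exact: le_normr_Rintegral. Qed.

Lemma Int_eq0_ae f : L1 f -> (forall x, 0 <= f x) -> \int[mu]_x f x = 0 ->
  f = (fun=> 0) %[ae mu].
Proof.
move=> lf f0 If.
have mf : measurable_fun setT (EFin \o f) := measurable_int _ lf.
have : ae_eq mu setT (EFin \o f) (cst 0%E).
  apply/(ae_eq_integral_abs mu measurableT mf).
  under eq_integral do rewrite /= ger0_norm//.
  by rewrite eintegral_Rintegral// If.
by apply: ae_imp => x /(_ I) [].
Qed.

Lemma measurable_affine (e a : R) : measurable_fun setT (fun x : R => e * x + a).
Proof. by apply: measurable_funD => //; exact: measurable_funM. Qed.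

(** [|e| = 1] covers translations and reflections at once. Lebesgue measure is determined by
    half-open intervals, and the preimage of such an interval is an interval of the same length. *)
Lemma measure_affine (e a : R) (A : set R) : `|e| = 1 -> measurable A ->
  pushforward mu ((fun x => e * x + a) : _ -> measurableTypeR R) A = mu A.
Proof.
move=> e1 mA; apply/esym/lebesgue_measure_unique => //=.
  exact: measurable_affine.
move=> mf _ [[p q]] _ <-; rewrite /pushforward.
have [e0|e0] := leP 0 e.
  have {}e1 : e = 1 by rewrite -(ger0_norm e0).
  have -> : (fun x => e * x + a) @^-1` `]p, q]%classic = `]p - a, q - a]%classic.
    by apply/seteqP; split=> x /=; rewrite !in_itv/= ltrBlDr lerBrDr e1 mul1r.
  rewrite !lebesgue_measure_itv/= !lte_fin ltrD2r; case: ifP => // _.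
  by rewrite -!EFinD; congr EFin; lra.
have {}e1 : e = -1 by rewrite -e1 ltr0_norm// opprK.
have -> : (fun x => e * x + a) @^-1` `]p, q]%classic = `[a - q, a - p[%classic.
  by apply/seteqP; split=> x /=; rewrite !in_itv/= e1 => /andP[? ?]; apply/andP; split; lra.
rewrite !lebesgue_measure_itv/= !lte_fin ltrD2l ltrN2; case: ifP => // _.
by rewrite -!EFinD; congr EFin; lra.
Qed.

Lemma measurable_comp_affine (e a : R) f : measurable_fun setT f ->
  measurable_fun setT (fun x => f (e * x + a)).
Proof. by move=> mf; apply: (measurableT_comp mf); exact: measurable_affine. Qed.

Lemma ge0_eintegral_affine (e a : R) f : `|e| = 1 -> measurable_fun setT f ->
  (forall x, 0 <= f x) ->
  (\int[mu]_x (f (e * x + a))%:E = \int[mu]_x (f x)%:E)%E.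
Proof.
move=> e1 mf f0.
have mT := @measurableT _ (measurableTypeR R).
have mEf : measurable_fun setT (EFin \o f) by exact/measurable_EFinP.
have := @ge0_integral_pushforward _ _ (measurableTypeR R) (measurableTypeR R) R
  _ (measurable_affine e a) mu setT (EFin \o f) mT mEf.
rewrite preimage_setT => <-; last by move=> x _; rewrite lee_fin.
apply: eq_measure_integral => [|mA A A' _]; first exact: measurable_affine.
exact: measure_affine.
Qed.

Lemma L1_affine (e a : R) f : `|e| = 1 -> L1 f -> L1 (fun x => f (e * x + a)).
Proof.
move=> e1 lf; have mf := L1_measurable lf.
apply/integrableP; split.
  by apply/measurable_EFinP; exact: measurable_comp_affine.
rewrite /=.
rewrite (ge0_eintegral_affine a e1 (f := fun x => `|f x|))//.
- by move/integrableP : lf => [].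
- exact: measurableT_comp.
Qed.

Lemma Int_affine (e a : R) f : `|e| = 1 -> L1 f ->
  \int[mu]_x f (e * x + a) = \int[mu]_x f x.
Proof.
move=> e1 lf; congr fine.
have mf := L1_measurable lf.
have mT := @measurableT _ (measurableTypeR R).
have mEf : measurable_fun setT (EFin \o f) by exact/measurable_EFinP.
have := @integral_pushforward _ _ (measurableTypeR R) (measurableTypeR R) R
  _ (measurable_affine e a) mu setT (EFin \o f) mEf.
rewrite preimage_setT => <- //; last exact: (L1_affine a e1 lf).
apply: eq_measure_integral => [|mA A A' _]; first exact: measurable_affine.
exact: measure_affine.
Qed.

Lemma ae_affine (e a : R) (P : R -> Prop) : `|e| = 1 ->
  {ae mu, forall x, P x} -> {ae mu, forall x, P (e * x + a)}.
Proof.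
move=> e1 [N [mN N0 PN]]; exists ((fun x => e * x + a) @^-1` N); split.
- by rewrite -[X in measurable X]setTI; exact: measurable_affine.
- by rewrite -[RHS]N0 -(measure_affine a e1 mN).
- by move=> x /= nP; exact: PN.
Qed.

End Integration.

(** * Convolution *)

Section Convolution.
Context {R : realType}.
Local Notation mu := (@lebesgue_measure R).
Local Notation T2 := (measurableTypeR R * measurableTypeR R)%type.
Implicit Types f g u v k phi : R -> R.

Lemma ae_eq_L1 (F : R -> \bar R) g : mu.-integrable setT F ->
  measurable_fun setT g -> ae_eq mu setT F (EFin \o g) -> L1 g.
Proof.
move=> /integrableP[mF Foo] mg Fg; apply/integrableP; split.
  exact/measurable_EFinP.
apply: le_lt_trans Foo; apply: ae_ge0_le_integral => //.
- by do 2 apply: measurableT_comp => //.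
- by apply: measurableT_comp.
- by move: Fg; apply: ae_imp => x /(_ I) -> _.
Qed.

(** The sections are integrable for almost every point, so the real iterated integrals agree with
    the extended ones up to null sets, and the extended theorem transfers. *)
Lemma fubini_Rintegral (h : T2 -> R) :
  (mu \x mu)%E.-integrable setT (EFin \o h) ->
  [/\ L1 (fun x => \int[mu]_y h (x, y)),
      measurable_fun setT (fun y => \int[mu]_x h (x, y)) &
      \int[mu]_x (\int[mu]_y h (x, y)) = \int[mu]_y (\int[mu]_x h (x, y))].
Proof.
move=> ih.
have aeF : ae_eq mu setT (fubini_F mu (EFin \o h))
    (fun x => (\int[mu]_y h (x, y))%:E).
  apply: ae_imp (ae_integrable1 ih) => x ix _.
  by rewrite /fubini_F /Rintegral fineK//; exact: integrable_fin_num ix.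
have aeG : ae_eq mu setT (fubini_G mu (EFin \o h))
    (fun y => (\int[mu]_x h (x, y))%:E).
  apply: ae_imp (ae_integrable2 ih) => y iy _.
  by rewrite /fubini_G /Rintegral fineK//; exact: integrable_fin_num iy.
have mF := measurable_fubini_F ih.
have mG := measurable_fubini_G ih.
have mF' : measurable_fun setT (fun x => (\int[mu]_y h (x, y))%:E).
  apply/measurable_EFinP; exact: (measurableT_comp (fine_measurable measurableT) mF).
have mG' : measurable_fun setT (fun y => (\int[mu]_x h (x, y))%:E).
  apply/measurable_EFinP; exact: (measurableT_comp (fine_measurable measurableT) mG).
split.
- by apply: (ae_eq_L1 _ _ aeF); [exact: integrable_fubini_F | exact/measurable_EFinP].
- exact/measurable_EFinP.
- rewrite {1}/Rintegral {2}/Rintegral; congr fine.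
  have <- := ae_eq_integral _ _ (@measurableT _ (measurableTypeR R)) mF mF' aeF.
  have <- := ae_eq_integral _ _ (@measurableT _ (measurableTypeR R)) mG mG' aeG.
  exact: Fubini.
Qed.

Lemma measurable_conv_kernel phi v k : measurable_fun setT phi ->
  measurable_fun setT v -> measurable_fun setT k ->
  measurable_fun setT (fun z : T2 => phi (z.1 - z.2) * v z.2 * k z.1).
Proof.
move=> mphi mv mk.
have m0 : measurable_fun setT (fun z : T2 => z.1 - z.2 : measurableTypeR R).
  by apply: measurable_funB; [exact: measurable_fst | exact: measurable_snd].
have c g := @measurableT_comp _ _ _ T2 (measurableTypeR R) R g setT.
apply: measurable_funM; first apply: measurable_funM.
- exact: (c phi _ mphi m0).
- exact: (c v _ mv measurable_snd).
- exact: (c k _ mk measurable_fst).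
Qed.

(** Tonelli, integrating in [x] first: by translation invariance the inner integral of the modulus
    is at most [M * |v y|] times the L^1 norm of [phi]. *)
Lemma integrable_conv_kernel phi v k (M : R) : L1 phi -> L1 v ->
  measurable_fun setT k -> (forall x, `|k x| <= M) ->
  (mu \x mu)%E.-integrable setT
    (EFin \o (fun z : T2 => phi (z.1 - z.2) * v z.2 * k z.1)).
Proof.
move=> lphi lv mk kM.
have mphi := L1_measurable lphi.
have mv := L1_measurable lv.
have mh := measurable_conv_kernel mphi mv mk.
apply/integrable21ltyP; first exact/measurable_EFinP.
pose N := \int[mu]_x `|phi x|.
apply: (@le_lt_trans _ _ (\int[mu]_y (M * N * `|v y|)%:E)%E); last first.
  by rewrite eintegral_Rintegral ?ltry//; exact/L1Z/L1_norm.
apply: ge0_le_integral => //.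
- by move=> y _; exact: integral_ge0.
- have m1 : measurable_fun setT (fun z : T2 => (`|phi (z.1 - z.2) * v z.2 * k z.1|%:E)).
    by apply/measurable_EFinP; exact: measurableT_comp.
  apply: (measurable_fun_fubini_tonelli_G _ m1) => z.
  by rewrite lee_fin.
- apply/measurable_EFinP/measurable_funM => //; exact: measurableT_comp.
- move=> y _ /=.
  apply: (@le_trans _ _ (\int[mu]_x (M * `|v y| * `|phi (1 * x - y)|)%:E)%E).
    apply: ge0_le_integral => //.
    + apply/measurable_EFinP; apply: measurableT_comp => //.
      apply: measurable_funM => //; apply: measurable_funM => //.
      by have := measurable_comp_affine 1 (- y) mphi; under eq_fun do rewrite mul1r.
    + apply/measurable_EFinP/measurable_funM => //.
      by apply: measurableT_comp => //; exact: measurable_comp_affine.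
    + move=> x _; rewrite lee_fin !normrM mul1r.
      rewrite [leRHS](_ : _ = `|phi (x - y)| * `|v y| * M); last by lra.
      by rewrite ler_wpM2l// mulr_ge0.
  have l1 := L1_affine (- y) (@normr1 R) lphi.
  rewrite eintegral_Rintegral; last exact/L1Z/L1_norm.
  rewrite IntZ; last exact: L1_norm.
  rewrite (Int_affine (- y) (@normr1 R) (f := fun x => `|phi x|)); last exact: L1_norm.
  by rewrite lee_fin -/N; lra.
Qed.

Lemma ae_conv_integrable phi v : L1 phi -> L1 v ->
  {ae mu, forall x, L1 (fun y => phi (x - y) * v y)}.
Proof.
move=> lphi lv.
have eqW1 : `|1 : R| <= 1 by rewrite normr1.
have mk : measurable_fun setT (fun _ : R => 1 : R) by [].
have := @integrable_conv_kernel phi v (fun=> 1) 1 lphi lv mk (fun _ => eqW1).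
move=> /ae_integrable1.
apply: ae_imp => x; apply: eq_integrable => // y _ /=.
by rewrite mulr1.
Qed.

Lemma L1_conv phi v : L1 phi -> L1 v -> L1 (convolution phi v).
Proof.
move=> lphi lv.
have eqW1 : `|1 : R| <= 1 by rewrite normr1.
have mk : measurable_fun setT (fun _ : R => 1 : R) by [].
have := @integrable_conv_kernel phi v (fun=> 1) 1 lphi lv mk (fun _ => eqW1).
move=> /fubini_Rintegral[+ _ _].
apply: eq_integrable => // x _ /=; congr (_%:E).
by apply: eq_Rintegral => y _ /=; rewrite mulr1.
Qed.

(** Fubini exchanges the two integrations and evenness turns [phi (x - y)] into [phi (y - x)]; the
    bound on [k] makes the kernel integrable on the plane. *)
Lemma conv_duality phi v k M : L1 phi -> phi = (fun x => phi (- x)) %[ae mu] ->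
  L1 v -> L1 k -> (forall x, `|k x| <= M) ->
  \int[mu]_x (convolution phi v x * k x) = \int[mu]_x (v x * convolution phi k x).
Proof.
move=> lphi /ae_eqP even lv lk kM.
have mk := L1_measurable lk.
have ik := integrable_conv_kernel lphi lv mk kM.
have [l1 l2 eq12] := fubini_Rintegral ik.
have lc := L1_conv lphi lv.
transitivity (\int[mu]_x \int[mu]_y (phi (x - y) * v y * k x)).
  apply: ae_Rintegral.
  - by apply: measurable_funM => //; exact: L1_measurable.
  - exact: (L1_measurable l1).
  - apply/ae_eqP; move: (ae_conv_integrable lphi lv); apply: ae_imp => x lx.
    rewrite mulrC /convolution -IntZ//.
    by apply: eq_Rintegral => y _; rewrite mulrC.
rewrite eq12 /=.
apply: ae_Rintegral.
- exact: l2.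
- by apply: measurable_funM; apply: L1_measurable => //; exact: L1_conv.
- apply/ae_eqP; move: (ae_conv_integrable lphi lk); apply: ae_imp => y ly.
  rewrite /convolution -IntZ//.
  apply: ae_Rintegral.
  + apply: measurable_funM => //; apply: measurable_funM => //.
    have := measurable_comp_affine 1 (- y) (L1_measurable lphi).
    by under eq_fun do rewrite mul1r.
  + by apply: measurable_funM => //; exact: L1_measurable.
  + apply/ae_eqP; have := ae_affine (- y) (@normr1 R) even.
    apply: ae_imp => x; rewrite mul1r opprB => ->; lra.
Qed.

(** For bounded [v] the integrand is integrable at every [x], not merely at almost every one; hence
    [convZ] and [convB] are equalities of functions. *)
Lemma conv_bound phi v (M : R) : L1 phi -> L1 v ->
  {ae mu, forall x, `|v x| <= M} -> forall x,
  L1 (fun y => phi (x - y) * v y) /\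
  `|convolution phi v x| <= M * \int[mu]_y `|phi y|.
Proof.
move=> lphi lv vM x.
have N1 : `|-1 : R| = 1 by rewrite normrN1.
have lx : L1 (fun y => phi (x - y)).
  by have := L1_affine x N1 lphi; under eq_fun do rewrite mulN1r addrC.
have lxv : L1 (fun y => phi (x - y) * v y).
  by apply: L1_mulb vM => //; exact: L1_measurable.
split => //; apply: (le_trans (le_norm_Int lxv)).
have <- : \int[mu]_y `|phi (x - y)| = \int[mu]_y `|phi y|.
  rewrite -(Int_affine x N1 (f := fun y => `|phi y|)); last exact: L1_norm.
  by apply: eq_Rintegral => y _; rewrite mulN1r addrC.
rewrite -IntZ; last exact: L1_norm.
apply: ae_le_Rintegral; first exact: L1_norm.
  exact/L1Z/L1_norm.
by move: vM; apply: ae_imp => y vM; rewrite normrM mulrC ler_wpM2r.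
Qed.

Lemma conv0 phi : convolution phi (fun=> 0) = (fun=> 0).
Proof.
apply/funext => x; rewrite /convolution (eq_Rintegral _ (g := fun=> 0)).
  by rewrite Rintegral_cst// mul0r.
by move=> y _; rewrite mulr0.
Qed.

Lemma convZ phi v (M t : R) : L1 phi -> L1 v -> {ae mu, forall x, `|v x| <= M} ->
  convolution phi (fun x => t * v x) = (fun x => t * convolution phi v x).
Proof.
move=> lphi lv vM; apply/funext => x.
rewrite /convolution -IntZ; last by have [] := conv_bound lphi lv vM x.
by apply: eq_Rintegral => y _; lra.
Qed.

Lemma convB phi u v (M N : R) : L1 phi -> L1 u -> L1 v ->
  {ae mu, forall x, `|u x| <= M} -> {ae mu, forall x, `|v x| <= N} ->
  convolution phi (fun x => u x - v x) =
  (fun x => convolution phi u x - convolution phi v x).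
Proof.
move=> lphi lu lv uM vN; apply/funext => x.
have [lux _] := conv_bound lphi lu uM x.
have [lvx _] := conv_bound lphi lv vN x.
by rewrite /convolution -IntB//; apply: eq_Rintegral => y _; lra.
Qed.

Lemma L1_sqr v (M : R) : L1 v -> {ae mu, forall x, `|v x| <= M} ->
  L1 (fun x => v x ^+ 2).
Proof. by move=> lv vM; apply: L1_mulb vM => //; exact: L1_measurable. Qed.

Lemma Lnorm2_sqr v : L1 (fun x => v x ^+ 2) ->
  ('N[mu]_2%:E[EFin \o v] ^+ 2 = (\int[mu]_x (v x ^+ 2))%:E)%E.
Proof.
move=> lv2.
have sq (x : \bar R) : (0 <= x -> x ^+ 2 = x `^ 2)%E.
  case: x => [r|_|//]; last by rewrite poweRyr// expe2 mulyy.
  by rewrite lee_fin => r0; rewrite poweR_EFin powR_mulrn// EFin_expe.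
rewrite sq ?Lnorm_ge0// powR_Lnorm//.
rewrite -eintegral_Rintegral//; apply: eq_integral => x _ /=.
by rewrite powR_mulrn// real_normK ?num_real.
Qed.

End Convolution.

(** * The hat function and its antiderivative *)

Section Ramps.
Context {R : realType}.
Local Notation mu := (@lebesgue_measure R).
Implicit Types h s t x y a b : R.

Definition pos_part t : R := Num.max t 0.
Definition sqr_ramp t : R := pos_part t ^+ 2 / 2.

Lemma pos_partP t : (t <= 0 /\ pos_part t = 0) \/ (0 <= t /\ pos_part t = t).
Proof. by rewrite /pos_part; have [h|h] := leP t 0; [left|right; rewrite ltW]. Qed.

Lemma continuous_pos_part : continuous pos_part.
Proof. by move=> t; apply: continuous_max; [exact: cvg_id | exact: cvg_cst]. Qed.

Lemma sqr_ramp_taylor t s :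
  `|sqr_ramp (t + s) - sqr_ramp t - pos_part t * s| <= s ^+ 2.
Proof.
rewrite /sqr_ramp ler_norml.
have [[h1 ->]|[h1 ->]] := pos_partP t; have [[h2 ->]|[h2 ->]] := pos_partP (t + s);
  by apply/andP; split; nra.
Qed.

(** Divided by [s], the quadratic remainder is at most [|s|]. This form treats the kink of
    [pos_part] at 0 like any other point. *)
Lemma is_derive_taylor (f : R -> R) t d :
  (forall s, `|f (t + s) - f t - d * s| <= s ^+ 2) -> is_derive t 1 f d.
Proof.
move=> fd.
have cv : (fun s : R => s^-1 *: (f (s *: (1 : R) + t) - f t)) @ 0^' --> d.
  apply/cvgrPdist_le => e e0; near=> s.
  have s0 : s != 0 by near: s; exact: nbhs_dnbhs_neq.
  have se : `|s| <= e.
    near: s; apply: dnbhs0_le => //.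
  have := fd s; rewrite -(@ler_pM2l _ `|s|^-1) ?invr_gt0 ?normr_gt0//.
  rewrite -normfV -normrM => H.
  rewrite distrC.
  rewrite [X in `|X| <= _](_ : _ = s^-1 * (f (t + s) - f t - d * s)); last first.
    by rewrite /GRing.scale/= mulr1 (addrC s) [RHS]mulrBr (mulrC d) mulrA mulVf// mul1r.
  apply: (le_trans H).
  rewrite -(real_normK (num_real s)) expr2 mulrA normfV mulVf ?normr_eq0// mul1r//.
apply: DeriveDef; first by apply/cvg_ex; exists d.
by apply: cvg_lim => //; exact: cv.
Unshelve. all: by end_near. Qed.

Lemma is_derive_sqr_ramp t : is_derive t 1 sqr_ramp (pos_part t).
Proof. by apply: is_derive_taylor => s; exact: sqr_ramp_taylor. Qed.

(* An antiderivative of [hat h], rising from 0 at [- h] to 1 at [h]. *)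
Definition hat_step h t : R :=
  (sqr_ramp (t + h) - 2 * sqr_ramp t + sqr_ramp (t - h)) / h ^+ 2.

(** The hat is a second difference of [pos_part]. Integrating it yields [hat_step] from [sqr_ramp];
    under a convolution it yields a second difference of [ramp_conv]. *)
Lemma hatE h t : 0 < h ->
  hat h t = (pos_part (t + h) - 2 * pos_part t + pos_part (t - h)) / h ^+ 2.
Proof.
move=> h0; rewrite /hat -exprVn.
have hk : h * h^-1 * h^-1 = h^-1 by rewrite divff ?mul1r// gt_eqF.
set k := h^-1 in hk *.
have [t0|t0] := leP 0 t; [rewrite ger0_norm//|rewrite ltr0_norm//].
  have -> : pos_part t = t by have [[? ->]|[]//] := pos_partP t; lra.
  have -> : pos_part (t + h) = t + h by have [[? ->]|[]//] := pos_partP (t + h); lra.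
  case: ifPn => [th|]; last rewrite -leNgt => th;
   have [[? ->]|[? ->]] := pos_partP (t - h); nra.
have -> : pos_part t = 0 by have [[? ->]//|[]] := pos_partP t; lra.
have -> : pos_part (t - h) = 0 by have [[? ->]//|[]] := pos_partP (t - h); lra.
case: ifPn => [th|]; last rewrite -leNgt => th;
  have [[? ->]|[? ->]] := pos_partP (t + h); nra.
Qed.


Lemma hat_ge0 h t : 0 < h -> 0 <= hat h t.
Proof.
move=> h0; rewrite /hat; case: ifPn => // th.
apply: mulr_ge0; first by rewrite invr_ge0 ltW.
by rewrite subr_ge0 ler_pdivrMr// mul1r ltW.
Qed.

Lemma hat_le h t : 0 < h -> hat h t <= h^-1.
Proof.
move=> h0; rewrite /hat; case: ifPn => // _; last by rewrite invr_ge0 ltW.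
apply: ler_piMr; first by rewrite invr_ge0 ltW.
by rewrite lerBlDr lerDl divr_ge0// ltW.
Qed.

Lemma hat_eq0 h t : h <= `|t| -> hat h t = 0.
Proof. by rewrite /hat leNgt => /negbTE ->. Qed.

Lemma hatN h t : hat h (- t) = hat h t.
Proof. by rewrite /hat normrN. Qed.

Lemma continuous_hat h : 0 < h -> continuous (hat h).
Proof.
move=> h0 t; rewrite (_ : hat h = fun t =>
  (pos_part (t + h) - 2 * pos_part t + pos_part (t - h)) / h ^+ 2); last first.
  by apply/funext => x; exact: hatE.
have sh (c : R) : (fun x => pos_part (x + c)) @ t --> pos_part (t + c).
  apply: (@continuous_comp _ _ _ (fun x => x + c) pos_part).
    by apply: cvgD; [exact: cvg_id|exact: cvg_cst].
  exact: continuous_pos_part.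
apply: cvgMl; apply: cvgD; last exact: sh.
apply: cvgB; first exact: sh.
by apply: cvgMr; exact: continuous_pos_part.
Qed.

Lemma is_derive_shift (f : R -> R) (c t d : R) :
  is_derive (t + c) 1 f d -> is_derive t 1 (fun x => f (x + c)) d.
Proof.
move=> fd; rewrite -[d]mulr1.
apply: (@is_derive1_comp _ f (fun x => x + c)) => //.
by apply: is_derive_eq; rewrite addr0.
Qed.

Lemma is_derive_hat_step h t : 0 < h -> is_derive t 1 (hat_step h) (hat h t).
Proof.
move=> h0; rewrite hatE//.
have d1 := is_derive_shift (is_derive_sqr_ramp (t + h)).
have d2 := is_derive_shift (is_derive_sqr_ramp (t - h)).
have d0 := is_derive_sqr_ramp t.
rewrite /hat_step.
apply: is_derive_eq.
by rewrite /GRing.scale/=; lra.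
Qed.

Lemma hat_step_l h t : t <= - h -> 0 < h -> hat_step h t = 0.
Proof.
move=> th h0; rewrite /hat_step /sqr_ramp.
have -> : pos_part t = 0 by have [[? ->]//|[? ->]] := pos_partP t; lra.
have -> : pos_part (t + h) = 0 by have [[? ->]//|[? ->]] := pos_partP (t + h); lra.
have -> : pos_part (t - h) = 0 by have [[? ->]//|[? ->]] := pos_partP (t - h); lra.
lra.
Qed.

Lemma hat_step_r h t : h <= t -> 0 < h -> hat_step h t = 1.
Proof.
move=> th h0; rewrite /hat_step /sqr_ramp.
have -> : pos_part t = t by have [[? ->]|[? ->]//] := pos_partP t; lra.
have -> : pos_part (t + h) = t + h by have [[? ->]|[? ->]//] := pos_partP (t + h); lra.
have -> : pos_part (t - h) = t - h by have [[? ->]|[? ->]//] := pos_partP (t - h); lra.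
apply: (@mulIf _ (h ^+ 2)); first by rewrite expf_neq0 ?gt_eqF.
by rewrite divfK ?expf_neq0 ?gt_eqF//; lra.
Qed.

(** Written with an indicator over the whole line, so that integrals over adjacent segments are
    added by linearity alone. *)
Lemma FTC_segment (F f : R -> R) a b : a <= b ->
  (forall x, is_derive x 1 F (f x)) -> continuous f ->
  L1 (fun x => \1_`[a, b]%classic x * f x) /\
  \int[mu]_x (\1_`[a, b]%classic x * f x) = F b - F a.
Proof.
move=> ab dF cf.
have E : (fun x => \1_`[a, b]%classic x * f x) = f \_ `[a, b].
  apply/funext => x; rewrite patchE indicE; case: ifPn => _; by rewrite (mul1r, mul0r).
have ib : mu.-integrable `[a, b] (EFin \o f).
  apply: continuous_compact_integrable; first exact: segment_compact.
  exact: continuous_subspaceT.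
rewrite E; split.
  rewrite /L1/= -restrict_EFin.
  have [+ _] := @integrable_mkcond _ (measurableTypeR R) R mu `[a, b]%classic
    (EFin \o f) (measurable_itv _).
  exact.
have -> : \int[mu]_x (f \_ `[a, b]) x = \int[mu]_(x in `[a, b]) f x.
  by rewrite [RHS]Rintegral_mkcond.
move: ab; rewrite le_eqVlt => /predU1P[<-|ab].
  by rewrite set_itv1 Rintegral_set1 subrr.
rewrite /Rintegral (@continuous_FTC2 _ f F)//.
- exact: continuous_subspaceT.
- have cF : continuous F.
    by move=> x; apply/differentiable_continuous/derivable1_diffP; case: (dF x).
  split.
  + by move=> x _; case: (dF x).
  + by apply: cvg_at_right_filter; exact: cF.
  + by apply: cvg_at_left_filter; exact: cF.
- by move=> x _; rewrite derive1E; case: (dF x).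
Qed.

Lemma hat_indic h t a b : a <= - h -> h <= b ->
  \1_`[a, b]%classic t * hat h t = hat h t.
Proof.
move=> ah hb; rewrite indicE; case: (boolP (t \in _)) => [_|/negP]; first by rewrite mul1r.
rewrite in_setE/= in_itv/= => /negP; rewrite negb_and -!ltNge => tab.
rewrite mul0r hat_eq0//; case/orP: tab => ?.
  by rewrite -normrN (le_trans _ (ler_norm _))//; lra.
by rewrite (le_trans _ (ler_norm _))//; lra.
Qed.

Lemma L1_hat h : 0 < h -> L1 (hat h) /\ \int[mu]_t hat h t = 1.
Proof.
move=> h0.
have hh : - h <= h by lra.
have [] := FTC_segment hh (fun t => is_derive_hat_step t h0) (continuous_hat h0).
under eq_fun do rewrite hat_indic//.
move=> l1 I1; split => //.
by rewrite I1 (hat_step_l (lexx _) h0) (hat_step_r (lexx _) h0) subr0.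
Qed.

Lemma hat_step_homo h s t : 0 < h -> s <= t -> hat_step h s <= hat_step h t.
Proof.
move=> h0 st.
have [_] := FTC_segment st (fun t => is_derive_hat_step t h0) (continuous_hat h0).
rewrite -subr_ge0 => <-; apply: Rintegral_ge0 => x _.
by rewrite mulr_ge0 ?hat_ge0.
Qed.

Lemma hat_step_ge0 h t : 0 < h -> 0 <= hat_step h t.
Proof.
move=> h0; have [th|th] := leP t (- h); first by rewrite hat_step_l.
by rewrite -(hat_step_l (lexx _) h0) hat_step_homo// ltW.
Qed.

Lemma hat_step_le1 h t : 0 < h -> hat_step h t <= 1.
Proof.
move=> h0; have [th|th] := leP h t; first by rewrite hat_step_r.
by rewrite -(hat_step_r (lexx _) h0) hat_step_homo// ltW.
Qed.

End Ramps.

(** * Total variation *)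

Section TotalVariation.
Context {R : realType}.
Local Notation mu := (@lebesgue_measure R).
Implicit Types (f g u v : R -> R) (x y : R).

Lemma Cc1_derive g x : Cc1 g -> is_derive x 1 g (derive1 g x).
Proof. by move=> [dg _ _]; rewrite derive1E; apply: DeriveDef. Qed.

Lemma Cc1I (g g' : R -> R) (M : R) : (forall x, is_derive x 1 g (g' x)) ->
  continuous g' -> (forall x, M < `|x| -> g x = 0) ->
  Cc1 g /\ derive1 g = g'.
Proof.
move=> dg cg gM.
have E : derive1 g = g' by apply/funext => x; rewrite derive1E; case: (dg x).
split => //; split; [by move=> x; case: (dg x)|by rewrite E|by exists M].
Qed.

(** On a segment the continuous derivative has a maximum; outside it [g] vanishes near the point,
    and so does its derivative. *)
Lemma Cc1_derive_bounded g : Cc1 g -> exists M : R, forall x, `|derive1 g x| <= M.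
Proof.
move=> [dg cg [M gM]].
have cn : {within `[- `|M|, `|M|], continuous (fun x => `|derive1 g x|)}.
  apply: continuous_subspaceT => x.
  by apply: cvg_norm; exact: cg.
have MM : - `|M| <= `|M| by rewrite (le_trans _ (normr_ge0 M))// oppr_le0.
have [c _ cmax] := EVT_max MM cn.
exists `|derive1 g c| => x.
have [xM|xM] := leP `|x| `|M|.
  by apply: cmax; rewrite in_itv/= -ler_norml.
suff -> : derive1 g x = 0 by rewrite normr0.
rewrite derive1E -(derive_cst (0 : R) x 1).
apply: near_eq_derive => //.
have : \forall y \near x, `|M| < `|y|.
  have /cvgr_gt : Num.norm y @[y --> x] --> `|x| by apply: cvg_norm; exact: cvg_id.
  exact.
apply: filterS => y My; apply: gM.
by rewrite (le_lt_trans _ My)// ler_norm.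
Qed.

Lemma L1_mul_test u g : L1 u -> Cc1 g -> L1 (fun x => u x * derive1 g x).
Proof.
move=> lu Cg; have [M gM] := Cc1_derive_bounded Cg.
apply: (@L1_mulb _ _ _ M) => //; last exact: aeW.
by case: Cg => _ cg _; exact: continuous_measurable_fun.
Qed.

Lemma TV_test u g : L1 u -> Cc1 g -> (forall x, `|g x| <= 1) ->
  ((\int[mu]_x (u x * derive1 g x))%:E <= TV u)%E.
Proof.
move=> lu Cg g1; rewrite -eintegral_Rintegral; last exact: L1_mul_test.
by apply: ereal_sup_ubound; exists g.
Qed.

Lemma Cc1_cst0 : Cc1 (fun=> 0 : R) /\ derive1 (fun=> 0 : R) = (fun=> 0).
Proof.
apply: (@Cc1I _ _ 0) => // x.
exact: cst_continuous.
Qed.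

Lemma TV_ge0 u : L1 u -> (0 <= TV u)%E.
Proof.
move=> lu; have [C0 d0] := Cc1_cst0.
have := TV_test lu C0 (fun x => ltac:(by rewrite normr0)).
rewrite d0; under eq_Rintegral do rewrite mulr0.
by rewrite (@Rintegral_cst _ _ R mu)// mul0r.
Qed.

Lemma TV_le u (M : R) : L1 u ->
  (forall g, Cc1 g -> (forall x, `|g x| <= 1) ->
     \int[mu]_x (u x * derive1 g x) <= M) -> (TV u <= M%:E)%E.
Proof.
move=> lu uM; apply: ub_ereal_sup => _ [g [Cg g1] <-].
rewrite eintegral_Rintegral; last exact: L1_mul_test.
by rewrite lee_fin uM.
Qed.

Lemma Cc1_comb (a : R) f g : Cc1 f -> Cc1 g ->
  Cc1 (fun x => a * f x + g x) /\
  derive1 (fun x => a * f x + g x) = (fun x => a * derive1 f x + derive1 g x).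
Proof.
move=> Cf Cg; have [_ cf [M fM]] := Cf; have [_ cg [N gN]] := Cg.
apply: (@Cc1I _ _ (Num.max M N)).
- move=> x; have df := Cc1_derive x Cf; have dg := Cc1_derive x Cg.
  by apply: is_derive_eq; rewrite /GRing.scale/=; lra.
- by move=> x; apply: cvgD; [apply: cvgMr; exact: cf|exact: cg].
- move=> x; rewrite gt_max => /andP[Mx Nx].
  by rewrite fM// gN// mulr0 addr0.
Qed.

(** The sign of [c] is moved into the test function; the added zero function only serves to obtain a
    multiple of [g] from [Cc1_comb]. *)
Lemma TV_scale_le (c : R) u (M : R) : L1 u -> (TV u <= M%:E)%E ->
  (TV (fun x => (c * u x)%R) <= (`|c| * M)%:E)%E.
Proof.
move=> lu uM; apply: TV_le; first exact: L1Z.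
move=> g Cg g1.
have [C0 d0] := Cc1_cst0.
have [Cs ds] := Cc1_comb (Num.sg c) Cg C0.
have sM : \int[mu]_x (u x * derive1 (fun x => Num.sg c * g x + 0) x) <= M.
  rewrite -lee_fin; apply: le_trans uM; apply: TV_test => // x.
  rewrite addr0 normrM; apply: mulr_ile1 => //.
  by rewrite normr_sg; case: (c != 0).
have E : \int[mu]_x (c * u x * derive1 g x) =
    `|c| * \int[mu]_x (u x * derive1 (fun x => Num.sg c * g x + 0) x).
  rewrite -IntZ; last exact: L1_mul_test.
  apply: eq_Rintegral => x _; rewrite ds d0 addr0.
  by rewrite [in LHS](numEsg c); lra.
by rewrite E ler_wpM2l.
Qed.

Lemma TV0 : TV (fun=> 0 : R) = 0%E.
Proof.
apply/eqP; rewrite eq_le TV_ge0 ?andbT; last exact: L1_cst0.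
apply: TV_le; first exact: L1_cst0.
move=> g _ _; under eq_Rintegral do rewrite mul0r.
by rewrite (@Rintegral_cst _ _ R mu)// mul0r.
Qed.

(** The integral of [u] against the derivative of [hat_step h (_ - x)], which ties it to the test
    functions of [TV]. With small [h] it mollifies [u]; with [h = sigma] it is the convolution with
    the kernel. *)
Definition hat_mean h u x : R := \int[mu]_y (u y * hat h (y - x)).

Fixpoint variation (w : R -> R) x (s : seq R) : R :=
  if s is y :: s' then `|w x - w y| + variation w y s' else 0.

Lemma hat_mean_L1 h u x : 0 < h -> L1 u -> L1 (fun y => u y * hat h (y - x)).
Proof.
move=> h0 lu; apply: (@L1_mulb _ _ _ h^-1) => //.
  have := measurable_comp_affine 1 (- x) (L1_measurable (L1_hat h0).1).
  by under eq_fun do rewrite mul1r.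
by apply: aeW => y; rewrite ger0_norm ?hat_ge0// hat_le.
Qed.

(* Between [x_j] and [x_(j+1)] the test function is the sign of the increment of
   the means; it is a combination of [hat_step h (_ - x_j)] with telescoping
   weights, which keeps it between -1 and 1. *)
Lemma variation_test h x s : 0 < h -> path <=%R x s -> forall u, L1 u ->
  exists g, [/\ Cc1 g, (forall y, `|g y| <= hat_step h (y - x)) &
    \int[mu]_y (u y * derive1 g y) = variation (hat_mean h u) x s].
Proof.
move=> h0 + u lu; elim: s x => [|x' s IH] x /=.
  move=> _; have [C0 d0] := Cc1_cst0; exists (fun=> 0); split => //.
    by move=> y; rewrite normr0 hat_step_ge0.
  rewrite d0; under eq_Rintegral do rewrite mulr0.
  by rewrite (@Rintegral_cst _ _ R mu)// mul0r.
move=> /andP[xx' /IH[g [Cg gle Ig]]].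
pose D y : R := hat_step h (y - x) - hat_step h (y - x').
have [CD dD] : Cc1 D /\ derive1 D = (fun y => hat h (y - x) - hat h (y - x')).
  apply: (@Cc1I _ _ (`|x| + `|x'| + h)).
  - move=> y.
    have d1 := is_derive_shift (is_derive_hat_step (y - x) h0).
    have d2 := is_derive_shift (is_derive_hat_step (y - x') h0).
    exact: is_deriveB.
  - have sh (c : R) : continuous (fun y => hat h (y - c)).
      move=> y; apply: (@continuous_comp _ _ _ (fun y => y - c) (hat h)).
        by apply: cvgB; [exact: cvg_id|exact: cvg_cst].
      exact: continuous_hat.
    by move=> y; apply: cvgB; exact: sh.
  - move=> y; rewrite /D.
    have := ler_norm x; have := ler_norm x'; have := lerNnormlW (lexx `|x|).
    have := lerNnormlW (lexx `|x'|).
    have [y0|y0] := ltP y 0 => *.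
      have := ltr0_norm y0 => E.
      by rewrite !hat_step_l ?subrr//; lra.
    have := ger0_norm y0 => E.
    by rewrite !hat_step_r ?subrr//; lra.
pose e : R := Num.sg (hat_mean h u x - hat_mean h u x').
have [Ce de] := Cc1_comb e CD Cg.
exists (fun y => e * D y + g y); split => //.
(* The bound telescopes: [D y] is non-negative and adds up with [hat_step h (y - x')] to
   [hat_step h (y - x)]. *)
- move=> y; apply: (le_trans (ler_normD _ _)).
  have -> : hat_step h (y - x) = D y + hat_step h (y - x') by rewrite /D subrK.
  apply: lerD => //; rewrite normrM.
  have D0 : 0 <= D y by rewrite subr_ge0 hat_step_homo// lerB.
  rewrite (ger0_norm D0) ler_piMl//.
  by rewrite /e normr_sg; case: (_ != 0).
- rewrite de dD -Ig.
  have l1 := hat_mean_L1 x h0 lu; have l2 := hat_mean_L1 x' h0 lu.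
  have -> : `|hat_mean h u x - hat_mean h u x'| =
     e * \int[mu]_y (u y * hat h (y - x) - u y * hat h (y - x')).
    by rewrite IntB// normrEsg.
  rewrite -(IntZ e (L1B l1 l2)) -(IntD (L1Z e (L1B l1 l2)) (L1_mul_test lu Cg)).
  by apply: eq_Rintegral => y _; lra.
Qed.

Lemma variation_hat_mean h u x s : 0 < h -> L1 u -> path <=%R x s ->
  ((variation (hat_mean h u) x s)%:E <= TV u)%E.
Proof.
move=> h0 lu xs; have [g [Cg gle <-]] := variation_test h0 xs lu.
by apply: TV_test => // y; rewrite (le_trans (gle y))// hat_step_le1.
Qed.

End TotalVariation.

(** * Variation at Lebesgue points *)

Section LebesguePoints.
Context {R : realType}.
Local Notation mu := (@lebesgue_measure R).
Implicit Types (f g u v : R -> R) (x y : R).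

Lemma ae_lebesgue_pt u : L1 u -> {ae mu, forall x, lebesgue_pt u x}.
Proof.
move=> lu; apply: lebesgue_differentiation.
by apply: open_integrable_locally => //; exact: openT.
Qed.

Lemma hat_shift h x : 0 < h ->
  L1 (fun y => hat h (y - x)) /\ \int[mu]_y hat h (y - x) = 1.
Proof.
move=> h0; have [lh Ih] := L1_hat h0.
have -> : (fun y => hat h (y - x)) = (fun y => hat h (1 * y + - x)).
  by apply/funext => y; rewrite mul1r.
by rewrite Int_affine ?normr1//; split => //; apply: L1_affine => //; rewrite normr1.
Qed.

(** The hat is at most [h^-1] and lives on a ball of length [2 h], so its mean of [|u - u x|] is at
    most twice the plain average. *)
Lemma hat_mean_davg u x (h e : R) : 0 < h -> L1 u -> (davg u x h < e%:E)%E ->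
  `|hat_mean h u x - u x| <= 2 * e.
Proof.
move=> h0 lu.
have h2 : 0 < h *+ 2 by rewrite mulrn_wgt0.
rewrite /davg /iavg (lebesgue_measure_ball x (ltW h0)) inver gt_eqF//.
rewrite lte_pdivrMl//.
pose f y := `|(u y - u x)%:E|%E; rewrite -[X in (X < _)%E]/(\int[mu]_(y in ball x h) f y)%E => Ie.
have [ls Is] := hat_shift x h0.
have l1 := hat_mean_L1 x h0 lu.
have l2 := L1Z (u x) ls.
have -> : hat_mean h u x - u x = \int[mu]_y (u y * hat h (y - x) - u x * hat h (y - x)).
  by rewrite IntB// IntZ// Is mulr1.
have l3 := L1B l1 l2.
apply: (le_trans (le_norm_Int l3)).
rewrite -lee_fin -eintegral_Rintegral; last exact: L1_norm.
have mf : measurable_fun setT f.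
  apply: measurableT_comp => //; apply/measurable_EFinP.
  by apply: measurable_funB => //; exact: L1_measurable.
have mb : measurable (ball x h : set (measurableTypeR R)) by exact: measurable_ball.
have fb0 y : (0 <= (f \_ (ball x h)) y)%E.
  by rewrite patchE; case: ifP => // _; rewrite /f abse_ge0.
apply: (@le_trans _ _ (\int[mu]_y ((h^-1)%:E * (f \_ (ball x h)) y))%E).
  apply: ge0_le_integral => //.
  - apply/measurable_EFinP; apply: measurableT_comp => //; exact: L1_measurable.
  - apply: measurable_funeM; apply/(measurable_restrictT _ _).1 => //.
    exact: measurable_funTS.
  - move=> y _; rewrite -mulrBl normrM (ger0_norm (hat_ge0 _ h0)).
    rewrite patchE; case: ifPn => [_|yb].
      by rewrite /f /= -EFinM lee_fin mulrC ler_wpM2r// hat_le.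
    rewrite mule0 lee_fin hat_eq0 ?mulr0//.
    move/negP: yb; rewrite in_setE -ball_normE/= distrC => /negP.
    by rewrite -leNgt.
rewrite ge0_integralZl_EFin//; last 2 first.
- by apply/(measurable_restrictT _ _).1 => //; exact: measurable_funTS.
- by rewrite invr_ge0 ltW.
rewrite -integral_mkcond -lee_pdivlMl ?invr_gt0// invrK.
by rewrite (le_trans (ltW Ie))// -EFinM lee_fin mulr2n; lra.
Qed.

Lemma hat_mean_cvg u x (e : R) : 0 < e -> L1 u -> lebesgue_pt u x ->
  \forall h \near 0^'+, `|hat_mean h u x - u x| <= e.
Proof.
move=> e0 lu lp.
have e2 : 0 < e / 2 by rewrite divr_gt0.
have : \forall h \near 0^'+, (davg u x h < (e / 2)%:E)%E.
  have n0 : nbhs (0%E : \bar R) [set y | (y < (e / 2)%:E)%E].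
    apply: open_nbhs_nbhs; split; last by rewrite /= lte_fin.
    exact: open_ereal_lt_ereal.
  exact: (lp _ n0).
have : \forall h \near 0^'+, 0 < h :> R by exact: nbhs_right_gt.
apply: filterS2 => h h0 dh.
by rewrite (le_trans (hat_mean_davg h0 lu dh))//; lra.
Qed.

Lemma variation_cvg u x s (e : R) : 0 < e -> L1 u ->
  lebesgue_pt u x -> (forall y, y \in s -> lebesgue_pt u y) ->
  \forall h \near 0^'+, variation u x s <= variation (hat_mean h u) x s + e.
Proof.
move=> + lu; elim: s x e => [|y s IH] x e e0 xu su /=.
  by apply: filterE => h; rewrite add0r ltW.
(* Two thirds are spent on the ends of the first increment, one on the rest of the list. *)
have e3 : 0 < e / 3 by rewrite divr_gt0.
have yu : lebesgue_pt u y by apply: su; rewrite mem_head.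
have := IH y (e / 3) e3 yu (fun z zs => su z (@mem_behead _ (y :: s) z zs)).
have := hat_mean_cvg e3 lu xu.
have := hat_mean_cvg e3 lu yu.
apply: filterS3 => h hy hx hs.
rewrite -addrA; have : variation u y s <= variation (hat_mean h u) y s + e / 3 by [].
have -> : u x - u y = (hat_mean h u x - hat_mean h u y) -
  (hat_mean h u x - u x) + (hat_mean h u y - u y) by lra.
have := ler_normD (hat_mean h u x - hat_mean h u y - (hat_mean h u x - u x))
  (hat_mean h u y - u y).
have := ler_normB (hat_mean h u x - hat_mean h u y) (hat_mean h u x - u x).
lra.
Qed.

(** Limit [h -> 0] in [variation_hat_mean]. Restricting to Lebesgue points gives a meaning to the
    values of a representative. *)
Lemma variation_le_TV u x s : L1 u -> path <=%R x s ->
  lebesgue_pt u x -> (forall y, y \in s -> lebesgue_pt u y) ->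
  ((variation u x s)%:E <= TV u)%E.
Proof.
move=> lu xs xu su; apply/lee_addgt0Pr => e e0.
have h0 : \forall h \near 0^'+, 0 < h :> R by exact: nbhs_right_gt.
have H : \forall h \near 0^'+, 0 < h :> R /\
    variation u x s <= variation (hat_mean h u) x s + e.
  by apply: filterI => //; exact: variation_cvg.
have [h [/= {}h0 he]] := @filter_ex _ _ (at_right_proper_filter 0) _ H.
apply: (@le_trans _ _ (variation (hat_mean h u) x s + e)%:E); first by rewrite lee_fin.
by rewrite EFinD leeD2r// variation_hat_mean.
Qed.

Lemma not_negligible_itv (a b : R) : a < b -> ~ {ae mu, forall x, ~ (a < x < b)}.
Proof.
move=> ab [N [mN N0 sN]].
have : (mu `]a, b[%classic <= mu N)%E.
  have mI : measurable (`]a, b[%classic : set (measurableTypeR R)).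
    exact: measurable_itv.
  apply: le_measure; [exact: mem_set|exact: mem_set|].
  by move=> x /=; rewrite in_itv/= => xab; exact: (sN x (fun nx => nx xab)).
rewrite N0 lebesgue_measure_itv/= lte_fin ab -EFinD lee_fin.
by rewrite leNgt subr_gt0 ab.
Qed.

(** The device by which sample points are chosen: a property that does not fail almost everywhere is
    met inside any set of full measure. *)
Lemma ae_exists (P Q : R -> Prop) : {ae mu, forall x, Q x} ->
  ~ {ae mu, forall x, ~ P x} -> exists x, P x /\ Q x.
Proof.
move=> aeQ nP; apply: contrapT => nPQ; apply: nP.
by move: aeQ; apply: ae_imp => x Qx Px; apply: nPQ; exists x.
Qed.

(** Otherwise the constant [e] would be dominated by [u], hence integrable over a line of infinite
    measure. *)
Lemma L1_small u (e : R) : 0 < e -> L1 u -> ~ {ae mu, forall x, ~ (`|u x| < e)}.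
Proof.
move=> e0 lu aeu.
have l1 : L1 (fun=> e : R).
  apply: (@L1_ae_le _ _ u) => //.
  by move: aeu; apply: ae_imp => x /negP; rewrite -leNgt (gtr0_norm e0).
have : (\int[mu]_x (e%:E) < +oo)%E by rewrite eintegral_Rintegral ?ltry.
have muT : mu [set: R] = +oo%E by rewrite -set_itvNyy lebesgue_measure_itv.
by rewrite integral_cst//= muT gt0_muley ?lte_fin.
Qed.

(** An integrable function is arbitrarily small at some Lebesgue point [y], and the two-point
    variation controls [|u x - u y|] at every Lebesgue point [x]. *)
Lemma BV_bound u (M : R) : L1 u -> (TV u <= M%:E)%E ->
  {ae mu, forall x, `|u x| <= M}.
Proof.
move=> lu uM; have aeu := ae_lebesgue_pt lu.
move: (aeu); apply: ae_imp => x xu; apply/ler_addgt0Pr => e e0.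
have [y [ye yu]] := ae_exists aeu (L1_small e0 lu).
have uxy : `|u x - u y| <= M.
  rewrite -lee_fin; apply: le_trans uM.
  have [xy|yx] := leP x y.
    have := @variation_le_TV u x [:: y] lu; rewrite /= xy addr0; apply=> //.
    by move=> z; rewrite inE => /eqP ->.
  have := @variation_le_TV u y [:: x] lu; rewrite /= (ltW yx) addr0 distrC; apply=> //.
  by move=> z; rewrite inE => /eqP ->.
have := ler_normD (u x - u y) (u y); rewrite subrK; lra.
Qed.

Lemma TV_eq0 u : L1 u -> TV u = 0%E -> u = (fun=> 0) %[ae mu].
Proof.
move=> lu u0; apply/ae_eqP; have := @BV_bound u 0 lu; rewrite u0.
move=> /(_ (lexx _)); apply: ae_imp => x.
by rewrite normr_le0 => /eqP.
Qed.

End LebesguePoints.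

(** * The trivial minimiser *)

Section Functional.
Context {R : realType}.
Local Notation mu := (@lebesgue_measure R).
Implicit Types (phi f g u v z : R -> R) (sigma lambda : R).

(** Reflection swaps the two summands of the defining formula. *)
Lemma kernelK_even sigma phi : kernelK sigma phi ->
  phi = (fun x => phi (- x)) %[ae mu].
Proof.
move=> [_ [p [_ _ _ /ae_eqP phiE]]]; apply/ae_eqP.
have := ae_affine 0 (@normrN1 R) phiE.
move: phiE; apply: ae_imp2 => x ->; rewrite mulN1r addr0 => ->.
have E (a b : R) : \1_`[a, b]%classic (- x) = \1_`[- b, - a]%classic x :> R.
  rewrite !indicE !mem_setE; congr ((_ : bool)%:R).
  by rewrite !in_itv/= lerNr lerNl andbC.
by rewrite !E !opprK oppr0 addrC.
Qed.

Lemma barcode_L1 z : barcode z -> L1 z.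
Proof. by move=> [[]]. Qed.

Lemma barcode_le1 z : barcode z -> {ae mu, forall x, `|z x| <= 1}.
Proof.
move=> [_ z01 _]; move: z01; apply: ae_imp => x [->|->].
  by rewrite normr0.
by rewrite normr1.
Qed.

Lemma conv_bounded phi v (M : R) : L1 phi -> L1 v ->
  {ae mu, forall x, `|v x| <= M} ->
  exists N : R, forall x, `|convolution phi v x| <= N.
Proof.
move=> lphi lv vM; exists (M * \int[mu]_y `|phi y|) => x.
by have [] := conv_bound lphi lv vM x.
Qed.

(** The square is expanded, and [conv_duality] turns the cross term into a pairing of [v] with
    [phi * f]. *)
Lemma F2E phi lambda f v (M N : R) : L1 phi -> phi = (fun x => phi (- x)) %[ae mu] ->
  L1 f -> (forall x, `|f x| <= N) -> L1 v -> {ae mu, forall x, `|v x| <= M} ->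
  F2 phi lambda f v = (TV v + (lambda * (\int[mu]_x (convolution phi v x ^+ 2) -
    2 * \int[mu]_x (v x * convolution phi f x) + \int[mu]_x (f x ^+ 2)))%:E)%E.
Proof.
move=> lphi even lf fN lv vM; rewrite /F2.
have lc := L1_conv lphi lv.
have [C cC] := conv_bounded lphi lv vM.
have lc2 : L1 (fun x => convolution phi v x ^+ 2) by apply: (L1_sqr lc); exact: aeW.
have lf2 : L1 (fun x => f x ^+ 2) by apply: (L1_sqr lf); exact: aeW.
have lcf : L1 (fun x => convolution phi v x * f x).
  by apply: (L1_mulb lc (L1_measurable lf)); exact: aeW.
have lcf2 := L1Z 2 lcf.
have E : (fun x => (convolution phi v x - f x) ^+ 2) =
    (fun x => convolution phi v x ^+ 2 - 2 * (convolution phi v x * f x) + f x ^+ 2).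
  by apply/funext => x; lra.
rewrite Lnorm2_sqr ?E; last exact: (L1D (L1B lc2 lcf2) lf2).
rewrite (IntD (L1B lc2 lcf2) lf2) (IntB lc2 lcf2) (IntZ 2 lcf).
by rewrite (conv_duality lphi even lv lf fN).
Qed.

Lemma BV_TV v : BV v -> exists T : R, [/\ TV v = T%:E, 0 <= T &
  {ae mu, forall x, `|v x| <= T}].
Proof.
move=> [lv Tv]; exists (fine (TV v)).
have vE : TV v = (fine (TV v))%:E.
  by rewrite fineK// ge0_fin_numE// TV_ge0.
split => //; first by rewrite -lee_fin -vE TV_ge0.
by apply: BV_bound => //; rewrite -vE.
Qed.

Lemma BV_cst0 : BV (fun=> 0 : R).
Proof. by split; [exact: L1_cst0|rewrite TV0 ltry]. Qed.

Lemma zero_unique_minimiserP phi lambda z : 0 < lambda -> L1 phi ->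
  phi = (fun x => phi (- x)) %[ae mu] -> L1 z -> {ae mu, forall x, `|z x| <= 1} ->
  let f := convolution phi z in
  unique_minimiser (F2 phi lambda f) (@BV R) (fun=> 0)
  <-> (dual_norm (convolution phi f) <= ((2 * lambda)^-1)%:E)%E.
Proof.
move=> l0 lphi even lz z1 f.
have lf : L1 f by exact: L1_conv.
have [N fN] := conv_bounded lphi lz z1.
have lk : L1 (convolution phi f) by exact: L1_conv.
have [K kK] : exists K : R, forall x, `|convolution phi f x| <= K.
  by apply: (conv_bounded (M := N) lphi lf); exact: aeW.
have lvk v : L1 v -> L1 (fun x => v x * convolution phi f x).
  by move=> lv; apply: (L1_mulb lv (L1_measurable lk)); exact: aeW.
(* The fidelity term is [A v - 2 P v + B], split into its quadratic, linear and constant parts in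
   [v]. *)
pose A v := \int[mu]_x (convolution phi v x ^+ 2).
pose P v := \int[mu]_x (v x * convolution phi f x).
pose B := \int[mu]_x (f x ^+ 2).
have F2v v T : L1 v -> TV v = T%:E ->
    F2 phi lambda f v = (T + lambda * (A v - 2 * P v + B))%:E.
  move=> lv Tv; rewrite (F2E (M := T) lambda lphi even lf fN lv) ?Tv//.
  by apply: BV_bound => //; rewrite Tv.
have F20 : F2 phi lambda f (fun=> 0) = (lambda * B)%:E.
  rewrite (F2v _ 0 L1_cst0 TV0) /A /P conv0.
  have I0 : \int[mu]_(x in setT) (0 : R) = 0.
    by rewrite (@Rintegral_cst _ _ R mu)// mul0r.
  under eq_Rintegral do rewrite expr0n/=.
  under [X in 2 * X]eq_Rintegral do rewrite mul0r.
  by rewrite I0; congr EFin; lra.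
have A0 v : 0 <= A v by apply: Rintegral_ge0 => x _; exact: sqr_ge0.
have dualE v : L1 v -> (`|\int[mu]_x (convolution phi f x * v x)%:E| = `|P v|%:E)%E.
  move=> lv; under eq_integral do rewrite mulrC.
  by rewrite eintegral_Rintegral//; exact: lvk.
have PZ c v : L1 v -> P (fun x => c * v x) = c * P v.
  move=> lv; rewrite /P -IntZ; last exact: lvk.
  by apply: eq_Rintegral => x _; rewrite mulrA.
split.
- move=> [[_ min0] _]; apply: ub_ereal_sup => _ [v [lv Tv] <-].
  rewrite dualE// lee_fin.
  have vb : {ae mu, forall x, `|v x| <= 1} by exact: BV_bound.
  (* Minimality of 0 is tested on [c * v], where [c] is [t] times the sign of [P v], and divided by
     [t]; the quadratic term keeps a factor [t]. *)
  have key (t : R) : 0 < t -> 2 * lambda * `|P v| <= 1 + lambda * t * A v.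
    move=> t0; pose c : R := t * Num.sg (P v).
    have ct : `|c| <= t.
      rewrite normrM (gtr0_norm t0); apply: ler_piMr; first exact: ltW.
      by rewrite normr_sg; case: (_ != 0).
    have lcv := L1Z c lv.
    have Tcv : (TV (fun x => (c * v x)%R) <= t%:E)%E.
      apply: (le_trans (TV_scale_le c lv Tv)).
      by rewrite mulr1 lee_fin.
    have bcv : BV (fun x => c * v x).
      by split => //; rewrite (le_lt_trans Tcv)// ltry.
    have [T [TE T0 _]] := BV_TV bcv.
    have := min0 _ bcv; rewrite F20 (F2v _ _ lcv TE) lee_fin.
    have Tt : T <= t by rewrite -lee_fin -TE.
    have -> : P (fun x => c * v x) = t * `|P v|.
      by rewrite PZ// /c -mulrA -normrEsg.
    have -> : A (fun x => c * v x) = c ^+ 2 * A v.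
      rewrite /A (convZ c lphi lv vb) -IntZ; last first.
        have [C cC] := conv_bounded lphi lv vb.
        by apply: (L1_sqr (L1_conv lphi lv)); exact: aeW.
      by apply: eq_Rintegral => x _; rewrite exprMn.
    have c2 : c ^+ 2 * A v <= t ^+ 2 * A v.
      rewrite ler_wpM2r// -(real_normK (num_real c)).
      by rewrite lerXn2r ?nnegrE// (le_trans _ ct).
    move=> h.
    have : t * (2 * lambda * `|P v|) <= t * (1 + lambda * t * A v).
      have : lambda * (c ^+ 2 * A v) <= lambda * (t ^+ 2 * A v) by rewrite ler_pM2l.
      lra.
    by rewrite ler_pM2l.
  rewrite -[leRHS]mul1r ler_pdivlMr ?mulr_gt0// mulrC.
  apply/ler_addgt0Pr => e e0.
  (* The choice [t = e / (lambda * A v + 1)] makes the quadratic term at most [e], even if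
     [A v = 0]. *)
  have d0 : 0 < lambda * A v + 1 by rewrite ltr_wpDl// mulr_ge0// ltW.
  have := key _ (divr_gt0 e0 d0).
  have : lambda * (e / (lambda * A v + 1)) * A v <= e.
    rewrite mulrAC mulrCA; apply: ler_piMr; first exact: ltW.
    by rewrite ler_pdivrMr// mul1r lerDl.
  lra.
- move=> dn.
  (* By homogeneity [v] is rescaled to total variation at most 1; dividing by [T + e] rather than
     [T] covers [T = 0]. *)
  have PT v T : L1 v -> TV v = T%:E -> 2 * lambda * P v <= T.
    move=> lv Tv; apply/ler_addgt0Pr => e e0.
    have T0 : 0 <= T by rewrite -lee_fin -Tv TV_ge0.
    have Te : 0 < T + e by lra.
    have lc := L1Z (T + e)^-1 lv.
    have Tc : (TV (fun x => ((T + e)^-1 * v x)%R) <= 1%:E)%E.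
      have vT : (TV v <= T%:E)%E by rewrite Tv.
      apply: (le_trans (TV_scale_le (T + e)^-1 lv vT)).
      rewrite gtr0_norm ?invr_gt0// lee_fin mulrC ler_pdivrMr// mul1r; lra.
    have : (`|P (fun x => (T + e)^-1 * v x)%R|%:E <= ((2 * lambda)^-1)%:E)%E.
      apply: le_trans dn; rewrite -dualE//; apply: ereal_sup_ubound.
      by exists (fun x => (T + e)^-1 * v x).
    rewrite lee_fin => /(le_trans (ler_norm _)); rewrite PZ//.
    by rewrite mulrC ler_pdivrMr// ler_pdivlMl ?mulr_gt0.
  split.
    split; first exact: BV_cst0.
    move=> v bv; have [T [TE T0 _]] := BV_TV bv.
    rewrite F20 (F2v _ _ bv.1 TE) lee_fin.
    have := PT _ _ bv.1 TE; have := A0 v => ? ?.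
    have : 0 <= lambda * A v by rewrite mulr_ge0// ltW.
    lra.
  move=> v [bv minv]; have [T [TE T0 vT]] := BV_TV bv.
  have := minv _ BV_cst0; rewrite F20 (F2v _ _ bv.1 TE) lee_fin => h.
  have := PT _ _ bv.1 TE => hP.
  have lA0 : lambda * A v <= 0 by lra.
  have Av0 : A v = 0.
    by apply/eqP; rewrite eq_le A0 andbT -(pmulr_rle0 _ l0).
  have [C cC] := conv_bounded lphi bv.1 vT.
  have c2 : L1 (fun x => convolution phi v x ^+ 2).
    by apply: (L1_sqr (L1_conv lphi bv.1)); exact: aeW.
  have /ae_eqP c0 := Int_eq0_ae c2 (fun x => sqr_ge0 _) Av0.
  have Pv0 : P v = 0.
    rewrite /P -(conv_duality lphi even bv.1 lf fN).
    transitivity (\int[mu]_(x in setT) (0 : R)).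
      apply: ae_Rintegral => //.
      - by apply: measurable_funM; apply: L1_measurable => //; exact: (L1_conv lphi bv.1).
      - apply/ae_eqP; move: c0; apply: ae_imp => x /eqP.
        by rewrite sqrf_eq0 => /eqP ->; rewrite mul0r.
    by rewrite (@Rintegral_cst _ _ R mu)// mul0r.
  apply: TV_eq0; first exact: bv.1.
  by move: h; rewrite TE Av0 Pv0 => h; congr EFin; lra.
Qed.

End Functional.

(** * Injectivity of the convolution with a hat *)

Section HatInjective.
Context {R : realType}.
Local Notation mu := (@lebesgue_measure R).
Implicit Types (u v w : R -> R) (h x y : R).

(** Descending induction: two consecutive zeros and the recurrence force the preceding term to
    vanish. *)
Lemma second_difference_eq0 (a : nat -> R) N :
  (forall m, a m - 2 * a m.+1 + a m.+2 = 0) -> (forall m, (N <= m)%N -> a m = 0) ->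
  a 0%N = 0.
Proof.
move=> da; elim: N => [|N IH] aN; first exact: aN.
apply: IH => m; rewrite leq_eqVlt => /predU1P[<-|]; last exact: aN.
by have := da N; rewrite (aN N.+1)// (aN N.+2)//; lra.
Qed.

Lemma hat_mean_conv h w x : convolution (hat h) w x = hat_mean h w x.
Proof. by apply: eq_Rintegral => y _; rewrite mulrC -hatN opprB. Qed.

(* The second antiderivative of [w] vanishing at [-oo]. *)
Definition ramp_conv w x : R := \int[mu]_y (w y * pos_part (x - y)).

(** * Functions vanishing almost everywhere on the negative half-line *)

Section Support.
Variable w : R -> R.
Hypothesis lw : L1 w.
Hypothesis w0 : {ae mu, forall y, y < 0 -> w y = 0}.

(** [pos_part (x - y)] grows as [y] tends to [-oo], but [w] vanishes there almost everywhere; for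
    [y >= 0] it is at most [|x|]. *)
Lemma ramp_L1 x : L1 (fun y => w y * pos_part (x - y)).
Proof.
have mp : measurable_fun setT (@pos_part R).
  by apply: continuous_measurable_fun; exact: continuous_pos_part.
apply: (@L1_ae_le _ _ (fun y => x * w y)).
- apply: measurable_funM; first exact: L1_measurable.
  have := measurable_comp_affine (-1) x mp.
  by under eq_fun do rewrite mulN1r addrC.
- exact: L1Z.
- move: w0; apply: ae_imp => y wy; have [y0|y0] := ltP y 0.
    by rewrite wy// mul0r mulr0.
  rewrite mulrC !normrM ler_wpM2r//.
  have := ler_norm x; have := normr_ge0 x.
  have [[? ->]|[p0 ->]] := pos_partP (x - y); first by rewrite normr0.
  by rewrite (ger0_norm p0); lra.
Qed.

Lemma hat_mean_ramp h x : 0 < h -> hat_mean h w x =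
  (ramp_conv w (x + h) - 2 * ramp_conv w x + ramp_conv w (x - h)) / h ^+ 2.
Proof.
move=> h0; have l1 := ramp_L1 (x + h); have l2 := L1Z 2 (ramp_L1 x).
have l3 := ramp_L1 (x - h).
rewrite /ramp_conv -(IntZ 2 (ramp_L1 x)) -(IntB l1 l2) -(IntD (L1B l1 l2) l3).
rewrite mulrC -(IntZ _ (L1D (L1B l1 l2) l3)).
apply: eq_Rintegral => y _.
rewrite -hatN opprB hatE//.
have -> : x - y + h = x + h - y by lra.
have -> : x - y - h = x - h - y by lra.
lra.
Qed.

Lemma ramp_conv_eq0 x : x <= 0 -> ramp_conv w x = 0.
Proof.
move=> x0; transitivity (\int[mu]_(y in setT) (0 : R)).
  apply: ae_Rintegral => //; first exact: (L1_measurable (ramp_L1 x)).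
  apply/ae_eqP; move: w0; apply: ae_imp => y wy; have [y0|y0] := ltP y 0.
    by rewrite wy// mul0r.
  have -> : pos_part (x - y) = 0 by have [[? ->]|[? ->]] := pos_partP (x - y); lra.
  by rewrite mulr0.
by rewrite (@Rintegral_cst _ _ R mu)// mul0r.
Qed.

(** For almost every [x], the sequence [ramp_conv w (x - m h)] has zero second differences and is
    eventually 0, so it is 0. Then all second differences of [ramp_conv w] at smaller steps vanish
    too, that is, the hat means of [w], and these converge to [w] at Lebesgue points. *)
Lemma hat_conv_injective h : 0 < h ->
  {ae mu, forall x, convolution (hat h) w x = 0} -> w = (fun=> 0) %[ae mu].
Proof.
move=> h0 cw.
have V0 : {ae mu, forall x, ramp_conv w x = 0}.
  have := ae_foralln (fun m => ae_affine (- (m%:R * h)) (@normr1 R) cw).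
  apply: ae_imp => x cx.
  have -> : ramp_conv w x = ramp_conv w (x - 0%:R * h) by rewrite mul0r subr0.
  (* From index [N.+1] on, [x - m h] is negative, where [ramp_conv w] vanishes. *)
  pose N := Num.truncn (`|x| / h).
  apply: (@second_difference_eq0 (fun m => ramp_conv w (x - m%:R * h)) N.+1) => m.
    have := cx m.+1; rewrite mul1r hat_mean_conv hat_mean_ramp//.
    have -> : x - m.+1%:R * h + h = x - m%:R * h by rewrite -natr1; lra.
    have -> : x - m.+1%:R * h - h = x - m.+2%:R * h by rewrite -[m.+2%:R]natr1; lra.
    by move/eqP; rewrite mulf_eq0 invr_eq0 expf_eq0/= (gt_eqF h0) orbF => /eqP.
  move=> Nm; apply: ramp_conv_eq0; rewrite subr_le0 -ler_pdivrMr//.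
  have xN : `|x| / h < N.+1%:R.
    by rewrite /N; have /andP[] := truncn_itv (divr_ge0 (normr_ge0 x) (ltW h0)).
  have : x / h <= `|x| / h by rewrite ler_pM2r ?invr_gt0// ler_norm.
  have : N.+1%:R <= m%:R :> R by rewrite ler_nat.
  lra.
apply/ae_eqP.
(* The steps [n.+1%:R^-1] tend to 0 and are countably many, so a single null set serves them all. *)
have V1 := ae_foralln (fun n => ae_affine (n.+1%:R^-1) (@normr1 R) V0).
have V2 := ae_foralln (fun n => ae_affine (- n.+1%:R^-1) (@normr1 R) V0).
have V12 : {ae mu, forall x, forall n, hat_mean n.+1%:R^-1 w x = 0}.
  have V3 : {ae mu, forall x, ramp_conv w x = 0 /\
      forall n, ramp_conv w (1 * x + n.+1%:R^-1) = 0}.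
    by move: V0 V1; apply: ae_imp2.
  move: V3 V2; apply: ae_imp2 => x [Vx V1x] V2x n.
  rewrite hat_mean_ramp ?invr_gt0//.
  have := V1x n; have := V2x n; rewrite !mul1r Vx => -> ->.
  by rewrite mulr0 subr0 addr0 mul0r.
move: (ae_lebesgue_pt lw) V12; apply: ae_imp2 => x lx Vx.
apply/eqP; rewrite -normr_le0; apply/ler_addgt0Pr => e e0; rewrite add0r.
have [d /= d0 dP] := hat_mean_cvg e0 lw lx.
have := truncn_itv (ltW (_ : 0 < d^-1)); rewrite invr_gt0 => /(_ d0)/andP[_ dn].
set n := Num.truncn d^-1 in dn.
have := dP (n.+1%:R^-1); rewrite Vx sub0r normrN; apply; last by rewrite invr_gt0.
by rewrite /= sub0r normrN ger0_norm// invf_plt ?posrE.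
Qed.

End Support.
End HatInjective.

(** * Energy of a missed interval *)

Section Energy.
Context {R : realType}.
Local Notation mu := (@lebesgue_measure R).
Implicit Types (u v w : R -> R) (s x y a b : R).

Lemma hat_stepNE s t : 0 < s -> 0 <= t <= s ->
  hat_step s (- t) = (1 - t / s) ^+ 2 / 2.
Proof.
move=> s0 /andP[t0 ts]; rewrite /hat_step /sqr_ramp.
have -> : pos_part (- t) = 0 by have [[? ->]|[? ->]] := pos_partP (- t); lra.
have -> : pos_part (- t + s) = s - t by have [[? ->]|[? ->]] := pos_partP (- t + s); lra.
have -> : pos_part (- t - s) = 0 by have [[? ->]|[? ->]] := pos_partP (- t - s); lra.
have -> : 1 - t / s = (s - t) / s by rewrite mulrBl divff// gt_eqF.
by rewrite expr_div_n; lra.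
Qed.

(** Reflecting a ramp gives [x ^+ 2 / 2] minus the ramp, and the second difference of [x ^+ 2 / 2]
    at step [s] is [s ^+ 2], whence the 1. *)
Lemma hat_stepN s t : 0 < s -> hat_step s (- t) = 1 - hat_step s t.
Proof.
move=> s0.
have s2 : s ^+ 2 != 0 by rewrite expf_neq0// gt_eqF.
have q2 (x : R) : sqr_ramp (- x) = x ^+ 2 / 2 - sqr_ramp x.
  rewrite /sqr_ramp.
  by have [[? ->]|[? ->]] := pos_partP x; have [[? ->]|[? ->]] := pos_partP (- x);
    first [lra | (have x0 : x = 0 by lra); rewrite x0; lra].
rewrite /hat_step.
apply: (mulIf s2); rewrite mulrBl !divfK// mul1r.
have -> : - t + s = - (t - s) by lra.
have -> : - t - s = - (t + s) by lra.
by rewrite !q2; lra.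
Qed.

(** With [k = t / s] the right-hand side is [2 k - k ^+ 2], at least [k] for [k] between 0 and 1. *)
Lemma hat_step_half s t : 0 < s -> 0 <= t <= s ->
  t / s <= 1 - 2 * hat_step s (- t).
Proof.
move=> s0 /andP[t0 ts]; rewrite hat_stepNE ?t0//.
have : 0 <= t / s by rewrite divr_ge0// ltW.
have : t / s <= 1 by rewrite ler_pdivrMr// mul1r.
set k := t / s; nra.
Qed.

Lemma indic_itvcc a b x : \1_`[a, b]%classic x = (a <= x <= b)%R%:R :> R.
Proof. by rewrite indicE mem_setE in_itv. Qed.

Lemma ae_neq a : {ae mu, forall y, y != a}.
Proof.
exists [set a]; split; [exact: measurable_set1|exact: lebesgue_measure_set1|].
by move=> y /= /negP; rewrite negbK => /eqP.
Qed.

(** Almost everywhere [e * w] is 1 on [[a, b]] and at least -1 elsewhere, so it dominates twice the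
    indicator minus 1; this is integrated against the hat centred at [x]. *)
Lemma conv_piece_bound s w a b (e : R) x : 0 < s -> L1 w ->
  {ae mu, forall y, `|w y| <= 1} -> `|e| = 1 ->
  {ae mu, forall y, a < y < b -> w y = e} -> a <= b ->
  2 * (hat_step s (b - x) - hat_step s (a - x)) - 1 <= `|hat_mean s w x|.
Proof.
move=> s0 lw w1 e1 we ab.
have [ls Is] := hat_shift x s0.
have [li Ii] : L1 (fun y => \1_`[a, b]%classic y * hat s (y - x)) /\
    \int[mu]_y (\1_`[a, b]%classic y * hat s (y - x)) =
    hat_step s (b - x) - hat_step s (a - x).
  apply: (FTC_segment (F := fun y => hat_step s (y - x)) ab).
    by move=> y; apply: is_derive_shift; exact: is_derive_hat_step.
  move=> y; apply: (@continuous_comp _ _ _ (fun y => y - x) (hat s)).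
    by apply: cvgB; [exact: cvg_id|exact: cvg_cst].
  exact: continuous_hat.
have lm := hat_mean_L1 x s0 lw.
have -> : 2 * (hat_step s (b - x) - hat_step s (a - x)) - 1 =
    \int[mu]_y (2 * (\1_`[a, b]%classic y * hat s (y - x)) - hat s (y - x)).
  by rewrite (IntB (L1Z 2 li) ls) (IntZ 2 li) Ii Is.
have -> : `|hat_mean s w x| = `|e * hat_mean s w x| by rewrite normrM e1 mul1r.
apply: le_trans (ler_norm _); rewrite /hat_mean -(IntZ e lm).
apply: ae_le_Rintegral; [exact: (L1B (L1Z 2 li) ls)|exact: L1Z|].
have ae3 : {ae mu, forall y, `|w y| <= 1 /\ (a < y < b -> w y = e)}.
  by move: w1 we; apply: ae_imp2.
have ae4 : {ae mu, forall y, y != a /\ y != b}.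
  by move: (ae_neq a) (ae_neq b); apply: ae_imp2.
move: ae3 ae4; apply: ae_imp2 => y [w1y wey] [ya yb].
have H0 := hat_ge0 (y - x) s0.
rewrite mulrA -[leLHS](_ : (2 * \1_`[a, b]%classic y - 1) * hat s (y - x) = _); last by lra.
rewrite mulrA ler_wpM2r// indicE.
have ew : `|e * w y| <= 1 by rewrite normrM e1 mul1r.
case: (boolP (y \in _)) => [|_].
  rewrite in_setE/= in_itv/= => /andP[ay yb'].
  rewrite wey; last by rewrite !lt_neqAle eq_sym ya ay yb yb'.
  by rewrite -expr2 -(real_normK (num_real e)) e1 expr1n/=; lra.
by have := lerNnormlW ew; rewrite /=; lra.
Qed.

(** As [[a, b]] has length at least [2 s], the window of half-width [s] around [x] passes at most
    one end. If it passes none, [conv_piece_bound] gives 1; if it passes one, [hat_step_half] makes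
    the bound linear. *)
Lemma hat_mean_piece s w a b (e : R) x : 0 < s -> L1 w ->
  {ae mu, forall y, `|w y| <= 1} -> `|e| = 1 ->
  {ae mu, forall y, a < y < b -> w y = e} -> 2 * s <= b - a -> a <= x <= b ->
  [/\ (x <= a + s -> (x - a) / s <= `|hat_mean s w x|),
      (b - s <= x -> (b - x) / s <= `|hat_mean s w x|) &
      (a + s <= x <= b - s -> 1 <= `|hat_mean s w x|)].
Proof.
move=> s0 lw w1 e1 we abs /andP[ax xb].
have ab : a <= b by lra.
have key := conv_piece_bound x s0 lw w1 e1 we ab.
split.
- move=> xas; rewrite (hat_step_r _ s0) in key; last by lra.
  have xs : 0 <= x - a <= s by lra.
  by have := hat_step_half s0 xs; rewrite opprB; lra.
- move=> bsx; rewrite (hat_step_l _ s0 (t := a - x)) in key; last by lra.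
  have xs : 0 <= b - x <= s by lra.
  by have := hat_step_half s0 xs; rewrite hat_stepN//; lra.
- move=> /andP[h1 h2]; rewrite (hat_step_r _ s0 (t := b - x)) in key; last by lra.
  by rewrite (hat_step_l _ s0 (t := a - x)) in key; lra.
Qed.

(* The bound is the integral of [min (1, d / s)^2], [d] the distance to [{a, b}]. *)
Lemma energy_piece s w a b (e : R) : 0 < s -> L1 w ->
  {ae mu, forall y, `|w y| <= 1} -> `|e| = 1 ->
  {ae mu, forall y, a < y < b -> w y = e} -> 2 * s <= b - a ->
  L1 (fun x => \1_`[a, b]%classic x * hat_mean s w x ^+ 2) ->
  b - a - 4 / 3 * s <= \int[mu]_x (\1_`[a, b]%classic x * hat_mean s w x ^+ 2).
Proof.
move=> s0 lw w1 e1 we abs lc.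
have cube (c x : R) : is_derive x 1 (fun x => (x - c) ^+ 3 / (3 * s ^+ 2))
    (((x - c) / s) ^+ 2).
  apply: is_derive_eq.
  rewrite /GRing.scale/= invfM expr_div_n; lra.
have csq (c : R) : continuous (fun x => ((x - c) / s) ^+ 2).
  move=> x; apply: cvgM; apply: cvgMl; (apply: cvgB; [exact: cvg_id|exact: cvg_cst]).
have as' : a <= a + s by lra.
have bs : b - s <= b by lra.
have ms : a + s <= b - s by lra.
have [l1 I1] := FTC_segment as' (cube a) (csq a).
have [l3 I3] := FTC_segment bs (cube b) (csq b).
have [l2 I2] := FTC_segment ms (fun x => is_derive_id x 1)
  (fun x => @cst_continuous _ _ (1 : R) x).
have s2 : s ^+ 2 != 0 by rewrite expf_neq0// gt_eqF.
have E1 : s ^+ 3 / (3 * s ^+ 2) = s / 3.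
  transitivity (s ^+ 2 / s ^+ 2 * (s / 3)); last by rewrite divff// mul1r.
  by rewrite invfM; lra.
(* The three terms contribute [s / 3], [b - a - 2 s] and [s / 3]. *)
have -> : b - a - 4 / 3 * s =
  \int[mu]_x (\1_`[a, a + s]%classic x * ((x - a) / s) ^+ 2 +
    \1_`[(a + s), (b - s)]%classic x * 1 +
    \1_`[(b - s), b]%classic x * ((x - b) / s) ^+ 2).
  rewrite (IntD (L1D l1 l2) l3) (IntD l1 l2) I1 I2 I3.
  have -> : a + s - a = s by lra.
  have -> : b - s - b = - s by lra.
  rewrite !subrr !expr0n/= !mul0r exprNn -signr_odd/= expr1 mulN1r mulNr E1; lra.
apply: ae_le_Rintegral; [exact: (L1D (L1D l1 l2) l3)|exact: lc|].
(* At these two points the segments overlap and the pointwise comparison may fail. *)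
have ae4 : {ae mu, forall y, y != a + s /\ y != b - s}.
  by move: (ae_neq (a + s)) (ae_neq (b - s)); apply: ae_imp2.
move: ae4; apply: ae_imp => x [xa xb0].
rewrite !indic_itvcc mulr1 -(real_normK (num_real (hat_mean s w x))).
have [axb|naxb] := boolP (a <= x <= b); last first.
  have nx p q : a <= p -> q <= b -> (p <= x <= q) = false.
    move=> ap qb; apply: contraNF naxb => /andP[px xq].
    by rewrite (le_trans ap px) (le_trans xq qb).
  have n1 : (a <= x <= a + s) = false by apply: nx; lra.
  have n2 : (a + s <= x <= b - s) = false by apply: nx; lra.
  have n3 : (b - s <= x <= b) = false by apply: nx; lra.
  by rewrite n1 n2 n3 /= !mul0r !add0r.
have [p1 p2 p3] := hat_mean_piece s0 lw w1 e1 we abs axb.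
case/andP: axb => ax xb; rewrite mul1r.
have [xas|xas] := leP x (a + s).
  have {}xas : x < a + s by rewrite lt_neqAle xa.
  have -> : (a + s <= x <= b - s) = false by rewrite leNgt xas.
  have -> : (b - s <= x <= b) = false by rewrite leNgt (lt_le_trans xas).
  rewrite ax mul0r !addr0 mul1r; apply: lerXn2r; rewrite ?nnegrE//; last exact: p1 (ltW xas).
  by apply: divr_ge0; [rewrite subr_ge0|exact: ltW].
rewrite andbF /= mul0r add0r.
have [bsx|bsx] := leP (b - s) x.
  have {}bsx : b - s < x by rewrite lt_neqAle eq_sym xb0.
  rewrite (leNgt x (b - s)) bsx andbF /= xb add0r mul1r -[leLHS]real_normK ?num_real//.
  apply: lerXn2r; rewrite ?nnegrE//; apply: le_trans (p2 (ltW bsx)).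
  rewrite normrM distrC (ger0_norm (_ : 0 <= b - x)) ?subr_ge0//.
  by rewrite (gtr0_norm (_ : 0 < s^-1)) ?invr_gt0.
rewrite (ltW xas) (ltW bsx)/= mul0r addr0.
by rewrite exprn_ege1// p3// (ltW xas) ltW.
Qed.

End Energy.

(** * Counting jumps *)

Section Pieces.
Context {R : realType}.
Local Notation mu := (@lebesgue_measure R).
Implicit Types (u v w z g : R -> R) (s x y a b l t om : R) (T : seq R) (c : bool).

(* [T] lists the jumps of [z] in [ ]l, +oo[ ], and [c] is its value just after
   [l].  Jumps are [om] apart, and [z] is 0 after the last one. *)
Fixpoint pieces z om l c T : Prop :=
  if T is t :: T' then
    [/\ om <= t - l, {ae mu, forall x, l < x < t -> z x = c%:R} &
        pieces z om t (~~ c) T']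
  else c = false /\ {ae mu, forall x, l < x -> z x = 0}.

Lemma L1_indic_mul (A : set R) f : measurable (A : set (measurableTypeR R)) -> L1 f ->
  L1 (fun x => \1_A x * f x).
Proof.
move=> mA lf; apply: (@L1_le _ _ f) => //.
  by apply: measurable_funM; [exact: measurable_indic|exact: L1_measurable].
move=> x; rewrite normrM indicE; case: (x \in A); rewrite ?normr1 ?normr0 ?mul1r//.
by rewrite mul0r.
Qed.

Lemma indic_itvoy l x : \1_`]l, +oo[%classic x = (l < x)%R%:R :> R.
Proof. by rewrite indicE mem_setE in_itv/= andbT. Qed.

(** A piece with value [c] contributes [c * (g t - g l)]. Together with the boundary term left by
    the pieces beyond [t], the jump at [t] costs [g t] or [- g t], hence at most 1. *)
Lemma pieces_test z om l c T g : L1 z -> 0 < om -> pieces z om l c T -> Cc1 g ->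
  (forall x, `|g x| <= 1) ->
  \int[mu]_x (\1_`]l, +oo[%classic x * (z x * derive1 g x)) <=
  (size T)%:R - c%:R * g l.
Proof.
move=> lz om0 + Cg g1; have lzg := L1_mul_test lz Cg.
have mI t : measurable (`]t, +oo[%classic : set (measurableTypeR R)).
  exact: measurable_itv.
elim: T l c => [|t T IH] l c /=.
  move=> [-> z0]; rewrite mul0r subr0.
  have -> : \int[mu]_x (\1_`]l, +oo[%classic x * (z x * derive1 g x)) =
      \int[mu]_(x in setT) (0 : R).
    apply: ae_Rintegral => //; first exact: L1_measurable (L1_indic_mul (mI l) lzg).
    apply/ae_eqP; move: z0; apply: ae_imp => x zx; rewrite indic_itvoy.
    by case: ltP => [/zx ->|_]; rewrite ?mul0r ?mulr0.
  by rewrite (@Rintegral_cst _ _ R mu)// mul0r.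
move=> [lt zc /IH]; set X := \int[mu]_x _ => IHt.
have lt' : l <= t by lra.
have cg : continuous (derive1 g) by case: Cg.
have [l1 I1] := FTC_segment lt' (fun x => Cc1_derive x Cg) cg.
have -> : \int[mu]_x (\1_`]l, +oo[%classic x * (z x * derive1 g x)) =
   c%:R * (g t - g l) + X.
  rewrite -I1 -(IntZ _ l1) -(IntD (L1Z c%:R l1) (L1_indic_mul (mI t) lzg)).
  apply: ae_Rintegral.
  - exact: L1_measurable (L1_indic_mul (mI l) lzg).
  - exact: L1_measurable (L1D (L1Z c%:R l1) (L1_indic_mul (mI t) lzg)).
  - have nlt : {ae mu, forall x, x != l /\ x != t}.
      by move: (ae_neq l) (ae_neq t); apply: ae_imp2.
    apply/ae_eqP; move: zc nlt; apply: ae_imp2 => x zx [xl xt].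
    rewrite !indic_itvoy indic_itvcc.
    have [lx|] := ltP l x; last first.
      rewrite le_eqVlt (negbTE xl)/= => xl'.
      rewrite (ltNge t) (le_trans (ltW xl') lt')/= leNgt xl'/=.
      by rewrite !mul0r mulr0 addr0.
    have [tx|xt'] := ltP t x.
      by rewrite andbF/= mul0r mulr0 add0r.
    have {}xt' : x < t by rewrite lt_neqAle xt.
    by rewrite zx ?lx// (ltW lx)/= mul0r addr0 !mul1r.
have := g1 t; rewrite ler_norml => /andP[g1t g2t].
by rewrite -natr1; case: (c) IHt => /=; lra.
Qed.

(** The jump from 0 to 1 at [t] is the boundary term [- g t], again at most 1; it accounts for the
    successor. *)
Lemma pieces_TV z om t T : L1 z -> 0 < om ->
  {ae mu, forall x, x < t -> z x = 0} -> pieces z om t true T ->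
  (TV z <= ((size T).+1%:R)%:E)%E.
Proof.
move=> lz om0 z0 zT; apply: TV_le => // g Cg g1.
have lzg := L1_mul_test lz Cg.
have -> : \int[mu]_x (z x * derive1 g x) =
    \int[mu]_x (\1_`]t, +oo[%classic x * (z x * derive1 g x)).
  apply: ae_Rintegral.
  - exact: L1_measurable lzg.
  - by apply: L1_measurable; apply: L1_indic_mul => //; exact: measurable_itv.
  - apply/ae_eqP; move: z0 (ae_neq t); apply: ae_imp2 => x zx xt.
    rewrite indic_itvoy; have [tx|] := ltP t x; first by rewrite mul1r.
    by rewrite le_eqVlt (negbTE xt)/= => /zx ->; rewrite mul0r mulr0.
apply: (le_trans (pieces_test lz om0 zT Cg g1)).
by have := g1 t; rewrite ler_norml -natr1 => /andP[g1t _] /=; lra.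
Qed.

(** * Lower bounds for the variation and the energy of a competitor *)

Section Competitor.
Variables (u z : R -> R) (s om K : R).
Hypotheses (s0 : 0 < s) (om2s : 2 * s <= om) (Kom : K <= om - 4 / 3 * s).
Hypotheses (bu : barcode u) (bz : barcode z).
Let w x := u x - z x.
Let c2 x := hat_mean s w x ^+ 2.
Hypothesis lc2 : L1 c2.

Let lu : L1 u. Proof. exact: barcode_L1. Qed.
Let lw : L1 w. Proof. by apply: L1B; exact: barcode_L1. Qed.

Let good x := lebesgue_pt u x /\ (u x = 0 \/ u x = 1).

Let ae_good : {ae mu, forall x, good x}.
Proof. by case: bu => _ u01 _; move: (ae_lebesgue_pt lu) u01; apply: ae_imp2. Qed.

Let w1 : {ae mu, forall x, `|w x| <= 1}.
Proof.
case: bu => _ u01 _; case: bz => _ z01 _; move: u01 z01; apply: ae_imp2 => x.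
by rewrite /w => -[->|->] [->|->]; rewrite ?subrr ?subr0 ?sub0r ?normrN ?normr0 ?normr1.
Qed.

Let good_dist x c : good x -> `|u x - c%:R| <= 1 /\ `|u x - c%:R| + `|u x - (~~ c)%:R| = 1.
Proof.
by move=> [_ [->|->]]; case: c; rewrite /= ?subrr ?subr0 ?sub0r ?normrN ?normr0 ?normr1;
  split; lra.
Qed.

(** [u] vanishes outside [[0, 1]], so good points of value 0 exist arbitrarily far out; [d] selects
    the side. They supply the two ends of the sampled sequence. *)
Let out_point l (d : bool) : exists x, [/\ good x, u x = 0 & if d then l < x else x < l].
Proof.
have [_ _ u0] := bu.
have [a [b [ab H]]] : exists a b, a < b /\ forall x, a < x < b ->
    x \notin `[0, 1] /\ (if d then l < x else x < l).
  case: d.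
    exists (Num.max l 1), (Num.max l 1 + 1); split; first by rewrite ltrDl.
    move=> x /andP[]; rewrite gt_max => /andP[lx x1] _; split => //.
    by rewrite in_itv/= negb_and -!ltNge x1 orbT.
  exists (Num.min l 0 - 1), (Num.min l 0); split; first by rewrite gtrBl.
  move=> x /andP[_]; rewrite lt_min => /andP[xl x0]; split => //.
  by rewrite in_itv/= negb_and -!ltNge x0.
have ae2 : {ae mu, forall x, good x /\ (x \notin `[0, 1] -> u x = 0)}.
  by move: ae_good u0; apply: ae_imp2.
have [x [/H[x01 xl] [gx ux]]] := ae_exists ae2 (not_negligible_itv ab).
by exists x; split => //; exact: ux.
Qed.

Let mI t : measurable (`]t, +oo[%classic : set (measurableTypeR R)).
Proof. exact: measurable_itv. Qed.

Let energy l := \int[mu]_x (\1_`]l, +oo[%classic x * c2 x).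

Let energy_ge0 l : 0 <= energy l.
Proof. by apply: Rintegral_ge0 => x _; rewrite mulr_ge0 ?sqr_ge0. Qed.

Let energy_homo l t : l <= t -> energy t <= energy l.
Proof.
move=> lt; apply: le_Int; try exact: L1_indic_mul.
move=> x; rewrite ler_wpM2r ?sqr_ge0// !indic_itvoy ler_nat.
by have [/(le_lt_trans lt) ->|_] := ltP t x.
Qed.

(** Being 0 or 1 and almost never [c], [u] equals [~~ c] almost everywhere on the interval; thus [w]
    is a constant of modulus 1 there and [energy_piece] applies. *)
Let energy_missed l t c : om <= t - l -> {ae mu, forall x, l < x < t -> z x = c%:R} ->
  {ae mu, forall x, ~ (l < x < t /\ u x = c%:R)} -> K + energy t <= energy l.
Proof.
move=> lt zc uc.
have wE : {ae mu, forall x, l < x < t -> w x = (~~ c)%:R - c%:R}.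
  case: bu => _ u01 _.
  have uE : {ae mu, forall x, l < x < t -> u x = (~~ c)%:R}.
    move: u01 uc; apply: ae_imp2 => x ux nux lxt.
    case: (c) nux ux => /= nux [] // ux; exfalso; exact: nux.
  by move: uE zc; apply: ae_imp2 => x ux zx lxt; rewrite /w ux// zx.
have e1 : `|(~~ c)%:R - c%:R : R| = 1.
  by case: (c); rewrite /= ?subr0 ?sub0r ?normrN normr1.
have mJ : measurable (`[l, t]%classic : set (measurableTypeR R)).
  exact: measurable_itv.
have lJ := L1_indic_mul mJ lc2.
have ts : 2 * s <= t - l by exact: le_trans lt.
have llt : l <= t by move: s0 ts; lra.
have := energy_piece s0 lw w1 e1 wE ts lJ.
(* Except at [l], the indicators of [[l, t]] and []t, +oo[] add up to that of []l, +oo[]. *)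
suff : \int[mu]_x (\1_`[l, t]%classic x * c2 x) + energy t <= energy l.
  rewrite -[X in X + _ <= _ -> _]/(\int[mu]_x (\1_`[l, t]%classic x * hat_mean s w x ^+ 2)).
  by move: Kom lt; set e := energy t; set e' := energy l; set i := Rintegral _ _ _; lra.
rewrite -(IntD lJ (L1_indic_mul (mI t) lc2)).
apply: ae_le_Rintegral.
- exact: (L1D lJ (L1_indic_mul (mI t) lc2)).
- exact: L1_indic_mul.
- move: (ae_neq l); apply: ae_imp => x xl.
  rewrite -mulrDl ler_wpM2r ?sqr_ge0// !indic_itvoy indic_itvcc -natrD ler_nat.
  rewrite le_eqVlt eq_sym (negbTE xl)/=.
  have [tx|xt] := ltP t x; first by rewrite andbF (le_lt_trans llt tx).
  by rewrite andbT addn0.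
Qed.

(* [m] counts the missed intervals to the right of [l].  The term [|u x - c|]
   keeps track of whether the variation still has to pay for the value [c] of
   [z] on the first interval. *)
Lemma competitor_pieces l c T : pieces z om l c T -> exists x r (m : nat),
  [/\ l < x, path <=%R x r, good x, (forall y, y \in r -> good y) &
   (size T)%:R + `|u x - c%:R| <= variation u x r + 2 * m%:R /\
   m%:R * K <= energy l].
Proof.
elim: T l c => [|t T IH] l c /=.
  move=> [-> _]; have [x [gx ux lx]] := out_point l true.
  exists x, [::], 0%N; split => //=; split; last by rewrite mul0r energy_ge0.
  by rewrite ux subrr normr0 mulr0 addr0.
move=> [lt zc /IH[x [r [m [tx xr gx gr [H1 H2]]]]]].
have lt' : l < t by move: s0 om2s lt; lra.
have [d1 d2] := good_dist c gx.
(* If the interval is missed, nothing is sampled: the extra jump and [|u x - c|], each at most 1,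
   are covered by the 2 that [m.+1] adds. *)
have [missed|] := pselect {ae mu, forall x, ~ (l < x < t /\ u x = c%:R)}.
  exists x, r, m.+1; split => //; first exact: lt_trans tx.
  split; last by have := energy_missed lt zc missed; rewrite -natr1; lra.
  have := normr_ge0 (u x - (~~ c)%:R).
  by rewrite -natr1 -[m.+1%:R]natr1; lra.
(* Otherwise a point [y] with [u y = c] is put in front. Its increment [|u x - c|] and the term
   [|u x - ~~ c|] from the induction add up to 1, which pays for the jump at [t]. *)
move=> /(ae_exists ae_good)[y [[/andP[ly yt] uy] gy]].
exists y, (x :: r), m; split => //.
- by rewrite /= (ltW (lt_trans yt tx)).
- by move=> y'; rewrite inE => /predU1P[->//|/gr].
split; last by rewrite (le_trans H2)// energy_homo// ltW.
rewrite /= uy subrr normr0 addr0 distrC -natr1; lra.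
Qed.

(** A point left of [t] with [u = 0] is put in front; its increment [|u x|] and the remaining
    [|u x - 1|] pay for the first jump. *)
Lemma competitor_bound t T : {ae mu, forall x, x < t -> z x = 0} ->
  pieces z om t true T -> exists m : nat,
  (((size T).+1%:R - 2 * m%:R)%:E <= TV u)%E /\ m%:R * K <= \int[mu]_x c2 x.
Proof.
move=> z0 /competitor_pieces[x [r [m [tx xr gx gr [H1 H2]]]]].
exists m; split; last first.
  apply: (le_trans H2); apply: le_Int => //; first exact: L1_indic_mul.
  move=> y; rewrite indic_itvoy ler_piMl ?sqr_ge0//.
  by case: ltP.
have [y [gy uy yt]] := out_point t false.
have := @variation_le_TV _ u y (x :: r) lu.
rewrite /= (ltW (lt_trans yt tx)) xr => /(_ isT gy.1) H.
apply: le_trans (H _); last first.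
  by move=> y'; rewrite inE => /predU1P[->|/gr[]//]; exact: gx.1.
rewrite lee_fin uy sub0r normrN -natr1.
have [_] := good_dist true gx; rewrite /= subr0; lra.
Qed.

End Competitor.
End Pieces.

(** * From bars to jumps *)

Section BarsToPieces.
Context {R : realType}.
Local Notation mu := (@lebesgue_measure R).
Implicit Types (z : R -> R) (om x a b l : R) (L : seq (R * R)).

Definition in_bars L x : bool := has (fun p : R * R => p.1 < x < p.2) L.

Lemma barcode_in_bars z L : barcode z -> level_intervals z true L ->
  {ae mu, forall x, z x = (in_bars L x)%:R}.
Proof.
move=> [_ z01 zout] [L01 _ zL].
have zz : {ae mu, forall x, (z x = 0 \/ z x = 1) /\ (x \notin `[0, 1] -> z x = 0)}.
  by move: z01 zout; apply: ae_imp2.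
move: zz zL; apply: ae_imp2 => x [z01x zoutx] zLx.
have [x01|x01] := boolP (x \in `[0, 1]).
  have [z1 z2] := zLx x01.
  have [/hasP[p pL xp]|nL] := boolP (in_bars L x).
    by apply: z2; exists p => //; rewrite in_itv.
  case: z01x => // /z1[p pL xp]; exfalso; move/negP: nL; apply.
  by apply/hasP; exists p => //; rewrite in_itv in xp.
rewrite zoutx//; case: (boolP (in_bars L x)) => // /hasP[p pL /andP[px xp]].
have [p0 _ p1] := L01 _ pL.
by move: x01; rewrite in_itv/= negb_and -!ltNge => /orP[]; lra.
Qed.

(** Some listed space meets []l, a[]. It cannot enter the neighbouring bars, where [z] is 1, so it
    lies in [[l, a]], and its length is at least [om]. *)
Lemma white_gap z om L p1 l a b : level_intervals z false L ->
  (forall p, p \in L -> om <= p.2 - p.1) ->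
  0 <= p1 -> p1 < l -> l < a -> a < b -> b <= 1 ->
  {ae mu, forall x, p1 < x < l -> z x = 1} ->
  {ae mu, forall x, l < x < a -> z x = 0} ->
  {ae mu, forall x, a < x < b -> z x = 1} -> om <= a - l.
Proof.
move=> [L01 _ zL] Lom p10 pl la ab b1 z1l z0 z1r.
have zz : {ae mu, forall x, (l < x < a -> z x = 0) /\ (x \in `[0, 1] ->
    z x = false%:R <-> exists2 p, p \in L & x \in `]p.1, p.2[)}.
  by move: z0 zL; apply: ae_imp2.
have [x [lxa [z0x zLx]]] := ae_exists zz (not_negligible_itv la).
have x01 : x \in `[0, 1] by rewrite in_itv/=; apply/andP; split; lra.
have [/(_ (z0x lxa))[p pL xp] _] := zLx x01.
rewrite in_itv/= in xp.
have [p0 p12 p21] := L01 _ pL.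
have disjoint (c d : R) : p.1 <= c -> c < d -> d <= p.2 ->
    {ae mu, forall x, c < x < d -> z x = 1} -> False.
  move=> pc cd dp zcd.
  have zz' : {ae mu, forall x, (c < x < d -> z x = 1) /\ (x \in `[0, 1] ->
      z x = false%:R <-> exists2 p, p \in L & x \in `]p.1, p.2[)}.
    by move: zcd zL; apply: ae_imp2.
  have [y [cyd [z1y zLy]]] := ae_exists zz' (not_negligible_itv cd).
  have y01 : y \in `[0, 1] by rewrite in_itv/=; apply/andP; split; lra.
  have [_ zy] := zLy y01.
  have zy0 : z y = false%:R.
    by apply: zy; exists p => //; rewrite in_itv/=; apply/andP; split; lra.
  by have := z1y cyd; rewrite zy0 => /eqP; rewrite eq_sym oner_eq0.
apply: le_trans (Lom _ pL) _.
have lp : l <= p.1.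
  rewrite leNgt; apply/negP => pl'.
  apply: (@disjoint (Num.max p.1 p1) l).
  - by rewrite le_max lexx.
  - by rewrite gt_max pl'.
  - lra.
  - move: z1l; apply: ae_imp => y zy /andP[].
    by rewrite gt_max => /andP[_ ?] ?; apply: zy; apply/andP.
have pa : p.2 <= a.
  rewrite leNgt; apply/negP => ap.
  apply: (@disjoint a (Num.min p.2 b)).
  - lra.
  - by rewrite lt_min ap.
  - by rewrite ge_min lexx.
  - move: z1r; apply: ae_imp => y zy /andP[?].
    by rewrite lt_min => /andP[_ ?]; apply: zy; apply/andP.
lra.
Qed.

Lemma in_bars_cons z a b L l : {ae mu, forall x, l < x -> z x = (in_bars ((a, b) :: L) x)%:R} ->
  l <= a -> a < b -> all (fun p : R * R => b < p.1) L ->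
  [/\ {ae mu, forall x, l < x < a -> z x = 0},
      {ae mu, forall x, a < x < b -> z x = 1} &
      {ae mu, forall x, b < x -> z x = (in_bars L x)%:R}].
Proof.
move=> zl la ab bL.
have nL x : x < b -> in_bars L x = false.
  move=> xb; apply/negbTE/hasPn => p /(allP bL) bp.
  by rewrite negb_and -!leNgt (ltW (lt_trans xb bp)).
split; move: zl; apply: ae_imp => x zx.
- move=> /andP[lx xa]; rewrite zx//= nL; last exact: lt_trans ab.
  by rewrite (ltNge a) (ltW xa).
- move=> /andP[ax xb]; rewrite zx/= ?ax ?xb//; exact: le_lt_trans la ax.
- move=> bx; rewrite zx/=; last by rewrite (le_lt_trans la)// (lt_trans ab).
  by rewrite (ltNge x) (ltW bx) andbF.
Qed.

Definition endpoints L : seq R := flatten [seq [:: p.1; p.2] | p <- L].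

Section Bars.
Variables (z : R -> R) (om : R) (spaces : seq (R * R)).
Hypothesis zspaces : level_intervals z false spaces.
Hypothesis spaces_om : forall p, p \in spaces -> om <= p.2 - p.1.

(** []p1, l[] is the preceding bar, carried along because [white_gap] needs a bar on either side of
    the gap. *)
Lemma bars_pieces L p1 l :
  (forall p, p \in L -> [/\ p.1 < p.2, p.2 <= 1 & om <= p.2 - p.1]) ->
  pairwise (fun p q : R * R => p.2 < q.1) L -> all (fun p : R * R => l < p.1) L ->
  0 <= p1 -> p1 < l -> {ae mu, forall x, p1 < x < l -> z x = 1} ->
  {ae mu, forall x, l < x -> z x = (in_bars L x)%:R} ->
  pieces z om l false (endpoints L).
Proof.
elim: L p1 l => [|[a b] L IH] p1 l Lom.
  by move=> _ _ _ _ _ zl; split => //; exact: zl.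
rewrite pairwise_cons => /andP[abL LL] /= /andP[la lL] p0 pl z1 zl.
have [ab b1 omab] := Lom (a, b) (mem_head _ _).
have [zla zab zb] := in_bars_cons zl (ltW la) ab abL.
split; [exact: (white_gap zspaces spaces_om p0 pl la ab b1)|exact: zla|].
split; [exact: omab|exact: zab|].
apply: (IH a b) => //.
- by move=> p pL; apply: Lom; rewrite inE pL orbT.
- by rewrite (le_trans p0)// (le_trans (ltW pl))// ltW.
Qed.

End Bars.

(** The reading starts at the left end of the first bar, so that every later gap lies between two
    bars; without bars [z] is null. *)
Lemma barcode_min_pieces z om : barcode_min om z ->
  z = (fun=> 0) %[ae mu] \/ exists t T, {ae mu, forall x, x < t -> z x = 0} /\
    pieces z om t true T.
Proof.
move=> [bz [bars [spaces [zbars zspaces bars_om spaces_om]]]].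
have zE := barcode_in_bars bz zbars.
have [bars01 bars_sorted _] := zbars.
case: bars zbars bars_om zE bars01 bars_sorted => [|[a b] L] zbars bars_om zE bars01 LL.
  by left; apply/ae_eqP; exact: zE.
right; exists a, (b :: endpoints L).
move: LL; rewrite pairwise_cons => /andP[abL LL].
have [/= a0 ab b1] := bars01 (a, b) (mem_head _ _).
(* [a - 1] is just some bound to the left of the first bar, as [in_bars_cons] asks for. *)
have zE' : {ae mu, forall x, a - 1 < x -> z x = (in_bars ((a, b) :: L) x)%:R}.
  by move: zE; apply: ae_imp => x ->.
have a1 : a - 1 <= a by lra.
have [_ zab zb] := in_bars_cons zE' a1 ab abL.
split.
  move: zE; apply: ae_imp => x -> xa.
  rewrite (_ : in_bars _ _ = false)//; apply/negbTE/hasPn => p.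
  rewrite inE => /predU1P[->|pL]; rewrite negb_and -!leNgt /=; apply/orP; left.
    exact: ltW.
  by have /= := allP abL _ pL; lra.
split; [exact: (bars_om (a, b) (mem_head _ _))|exact: zab|].
apply: (bars_pieces zspaces spaces_om (p1 := a)) => //.
move=> p pL; have pL' : p \in (a, b) :: L by rewrite inE pL orbT.
by have [_ ? ?] := bars01 _ pL'; split => //; exact: bars_om.
Qed.

End BarsToPieces.

(** * The bar code as minimiser *)

Section BarcodeMinimiser.
Context {R : realType}.
Local Notation mu := (@lebesgue_measure R).
Implicit Types (u v w z : R -> R).

(** By linearity of the convolution the fidelity term is the energy of [u - z], expressed with
    [hat_mean], to which the estimates on missed intervals apply. *)
Lemma F2_hatE sigma lambda u z : 0 < sigma -> barcode u -> barcode z ->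
  let w x := u x - z x in
  L1 (fun x => hat_mean sigma w x ^+ 2) /\
  F2 (hat sigma) lambda (convolution (hat sigma) z) u =
  (TV u + (lambda * \int[mu]_x (hat_mean sigma w x ^+ 2))%:E)%E.
Proof.
move=> s0 bu bz w; have [lh _] := L1_hat s0.
have lu := barcode_L1 bu; have lz := barcode_L1 bz.
have u1 := barcode_le1 bu; have z1 := barcode_le1 bz.
have lw : L1 w by exact: L1B.
have w2 : {ae mu, forall x, `|w x| <= 2}.
  move: u1 z1; apply: ae_imp2 => x ux zx.
  by rewrite (le_trans (ler_normB _ _))//; lra.
have [C cC] := conv_bounded lh lw w2.
have l2 : L1 (fun x => convolution (hat sigma) w x ^+ 2).
  by apply: (L1_sqr (L1_conv lh lw)); exact: aeW.
have E : (fun x => hat_mean sigma w x ^+ 2) = (fun x => convolution (hat sigma) w x ^+ 2).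
  by apply/funext => x; rewrite hat_mean_conv.
rewrite E; split => //; rewrite /F2.
have -> : (fun x => convolution (hat sigma) u x - convolution (hat sigma) z x) =
    convolution (hat sigma) w by rewrite /w (convB lh lu lz u1 z1).
by rewrite (Lnorm2_sqr l2).
Qed.

Lemma barcode_unique_minimiser omega sigma lambda z (A : set (R -> R)) :
  0 < sigma -> 0 < lambda -> barcode_min omega z ->
  sigma <= omega / 2 -> 2 / lambda + 21 / 15 * sigma < omega ->
  A `<=` @barcode R -> A z ->
  unique_minimiser (F2 (hat sigma) lambda (convolution (hat sigma) z)) A z.
Proof.
move=> s0 l0 hz so lo Abar Az.
have bz := hz.1; have lz := barcode_L1 bz.
have om0 : 0 < omega by lra.
pose E u := \int[mu]_x (hat_mean sigma (fun x => u x - z x) x ^+ 2).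
have F2u u : barcode u -> F2 (hat sigma) lambda (convolution (hat sigma) z) u =
    (TV u + (lambda * E u)%:E)%E.
  by move=> bu; have [_] := F2_hatE lambda s0 bu bz.
have E0 u : 0 <= E u by apply: Rintegral_ge0 => x _; exact: sqr_ge0.
have F2z : F2 (hat sigma) lambda (convolution (hat sigma) z) z = TV z.
  rewrite F2u// (_ : E z = 0) ?mulr0 ?adde0//.
  transitivity (\int[mu]_(x in setT) (0 : R)).
    apply: eq_Rintegral => x _; rewrite -hat_mean_conv.
    have -> : (fun x => z x - z x) = (fun=> 0) by apply/funext => y; rewrite subrr.
    by rewrite conv0 expr0n.
  by rewrite (@Rintegral_cst _ _ R mu)// mul0r.
(* Energy guaranteed per missed interval, as 21/15 exceeds 4/3. The assumption reads
   [2 / lambda < K]: missing an interval saves at most 2 in variation but costs more than 2 in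
   fidelity. *)
pose K := omega - 21 / 15 * sigma.
have K2 : 2 < lambda * K.
  have : 2 / lambda < K by rewrite /K; lra.
  by rewrite ltr_pdivrMr// mulrC.
have [N [NT lower]] : exists N : nat, (TV z <= N%:R%:E)%E /\ forall u, barcode u ->
    exists m : nat, ((N%:R - 2 * m%:R)%:E <= TV u)%E /\ m%:R * K <= E u.
  have [z0|[t [T [zt zT]]]] := barcode_min_pieces hz.
    exists 0%N; split.
      apply: TV_le => // g Cg _.
      rewrite (_ : \int[mu]_x _ = \int[mu]_(x in setT) (0 : R)).
        by rewrite (@Rintegral_cst _ _ R mu)// mul0r.
      apply: ae_Rintegral => //; first exact: L1_measurable (L1_mul_test lz Cg).
      by apply/ae_eqP; move/ae_eqP: z0; apply: ae_imp => x ->; rewrite mul0r.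
    move=> u bu; exists 0%N; split; last by rewrite mul0r.
    by rewrite mulr0 subrr TV_ge0//; exact: barcode_L1.
  exists (size T).+1; split; first exact: pieces_TV zT.
  move=> u bu; have [l2 _] := F2_hatE lambda s0 bu bz.
  apply: (competitor_bound s0 _ _ bu bz l2 zt zT); rewrite /K; lra.
have key u : barcode u -> (TV z <= F2 (hat sigma) lambda (convolution (hat sigma) z) u)%E /\
   ((F2 (hat sigma) lambda (convolution (hat sigma) z) u <= TV z)%E -> E u = 0).
  move=> bu; have [m [mu mE]] := lower u bu.
  have lE : 0 <= lambda * E u by rewrite mulr_ge0// ltW.
  have m0 : 0 <= m%:R * (lambda * K - 2) by rewrite mulr_ge0// subr_ge0 ltW.
  have lmE : lambda * (m%:R * K) <= lambda * E u by rewrite ler_pM2l.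
  have mF : ((N%:R - 2 * m%:R + lambda * E u)%:E <=
      F2 (hat sigma) lambda (convolution (hat sigma) z) u)%E.
    by rewrite F2u// EFinD leeD2r.
  split.
    by apply: (le_trans NT); apply: le_trans mF; rewrite lee_fin; lra.
  move=> Fz; have := le_trans mF (le_trans Fz NT); rewrite lee_fin => h.
  (* Without missed intervals the fidelity term must vanish; with some, the strict gain
     [m * (lambda * K - 2)] contradicts [h]. *)
  case: m => [|m] in mu mE m0 lmE mF h *.
    have : lambda * E u <= 0 by lra.
    rewrite pmulr_rle0// => Eu; apply/eqP; rewrite eq_le Eu/=; exact: E0.
  have : 0 < m.+1%:R * (lambda * K - 2) by rewrite mulr_gt0// subr_gt0.
  lra.
split.
  by split => // v /Abar bv; rewrite F2z; have [] := key v bv.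
move=> v [Av minv]; have bv := Abar _ Av.
have Ev0 : E v = 0.
  by have [_] := key v bv; apply; rewrite -F2z; exact: minv.
have [l2 _] := F2_hatE lambda s0 bv bz.
have /ae_eqP c0 := Int_eq0_ae l2 (fun x => sqr_ge0 _) Ev0.
have lw : L1 (fun x => v x - z x) by apply: L1B => //; exact: barcode_L1.
have w0 : {ae mu, forall y, y < 0 -> v y - z y = 0}.
  case: bv => _ _ v0; case: bz => _ _ z0; move: v0 z0; apply: ae_imp2 => y vy zy y0.
  have ny : y \notin `[0, 1] by rewrite in_itv/= negb_and -!ltNge y0.
  by rewrite vy// zy// subrr.
have /ae_eqP vz : (fun x => v x - z x) = (fun=> 0) %[ae mu].
  apply: (hat_conv_injective lw w0 s0); move: c0; apply: ae_imp => x /eqP.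
  by rewrite sqrf_eq0 hat_mean_conv => /eqP.
by apply/ae_eqP; move: vz; apply: ae_imp => x /eqP; rewrite subr_eq0 => /eqP.
Qed.

End BarcodeMinimiser.

Theorem corollary1p3 (R : realType) (omega sigma lambda : R) (z : R -> R)
    (omega_gt0 : 0 < omega) (sigma_gt0 : 0 < sigma) (lambda_gt0 : 0 < lambda)
    (hz : barcode_min omega z) :
  (forall phi : R -> R, kernelK sigma phi ->
     let f := convolution phi z in
     unique_minimiser (F2 phi lambda f) (@BV R) (fun=> 0)
     <-> (dual_norm (convolution phi f) <= ((2 * lambda)^-1)%:E)%E)
  /\
  (forall i j : bool, barcode_min_ij omega i j z ->
     sigma <= omega / 2 ->
     2 / lambda + 21 / 15 * sigma < omega ->
     let phi := hat sigma in
     let f := convolution phi z in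
     unique_minimiser (F2 phi lambda f) (barcode_ij i j) z).
Proof.
split.
  move=> phi Kphi; apply: zero_unique_minimiserP => //.
  - exact: Kphi.1.
  - exact: kernelK_even Kphi.
  - exact: barcode_L1 hz.1.
  - exact: barcode_le1 hz.1.
move=> i j [_ ij] so lo; apply: (@barcode_unique_minimiser R omega) => //.
- by move=> u [].
- by split => //; exact: hz.1.
Qed.
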